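(* For any integers $k\ge 2$ and $d\ge 2$, there exists $n_0$ such that for all $n\ge n_0$ the Hilbert series of $R_{n,n+k,d}$ differs from the Hilbert series predicted by Fröberg for $n+k$ generic forms of degree $d$ in $n$ variables.
   Context: Let $\Bbbk$ be a field of characteristic zero and $S=\Bbbk[x_1,\ldots,x_n]$ with the standard grading. For positive integers $n,m,d$, $R_{n,m,d}=S/(\ell_1^d,\ldots,\ell_m^d)$, where $\ell_1,\ldots,\ell_m$ are general linear forms, i.e. statements hold for all $(\ell_1,\dots,\ell_m)$ in some nonempty Zariski open subset of $(S_1)^m$. The series predicted by Fröberg for $m$ generic forms of degree $d$ in $n$ variables is $\left[\frac{(1-t^d)^m}{(1-t)^n}\right]$, where the brackets mean truncation at the first non-positive term: $[\sum_i c_it^i]=\sum_{i<i_0}c_it^i$ with $i_0$ the least index such that $c_{i_0}\le 0$ (no truncation if there is none). *)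

(* Defs.v *)
From HB Require Import structures.
From mathcomp Require Import all_boot all_order all_algebra.
From mathcomp Require Import mpoly ring.
From Stdlib Require Import ClassicalEpsilon.
Set Implicit Arguments.
Unset Strict Implicit.
Unset Printing Implicit Defensive.
Import Order.TTheory GRing.Theory Num.Theory.
Local Open Scope ring_scope.

(* Zariski topology on the affine space of m x n matrices: an open set is the
   complement of the common zero locus of a set Q of polynomials in the m * n
   entries. *)
Definition zariski_open (K : fieldType) (m n : nat) (U : 'M[K]_(m, n) -> Prop)
    : Prop :=
  exists Q : {mpoly K[m * n]} -> Prop,
    forall A, U A <-> exists2 q, Q q & q.@[fun i => mxvec A 0 i] != 0.

(* The m-tuple of linear forms whose coefficients are the rows of A; this
   identifies 'M_(m, n) with (S_1)^m. *)
Definition linear_forms (K : fieldType) (m n : nat) (A : 'M[K]_(m, n))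
    : 'I_m -> {mpoly K[n]} :=
  fun i => \sum_(j < n) A i j *: 'X_j.

Definition for_general_linear_forms (K : fieldType) (m n : nat)
    (P : ('I_m -> {mpoly K[n]}) -> Prop) : Prop :=
  exists U : 'M[K]_(m, n) -> Prop,
    [/\ zariski_open U, (exists A, U A)
      & forall A, U A -> P (linear_forms A)].

Definition ideal_gen (K : fieldType) (m n : nat) (f : 'I_m -> {mpoly K[n]})
    : {mpoly K[n]} -> Prop :=
  fun p => exists g : 'I_m -> {mpoly K[n]}, p = \sum_(j < m) g j * f j.

(* The classes of r suitable forms of degree i are a basis of the degree i
   component S_i / (I \cap S_i) of S / I, for I a homogeneous ideal of S. *)
Definition quotient_dim (K : fieldType) (n : nat) (I : {mpoly K[n]} -> Prop)
    (i r : nat) : Prop :=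
  exists2 e : 'I_r -> {mpoly K[n]}, (forall j, e j \is i.-homog) &
    forall p : {mpoly K[n]}, p \is i.-homog ->
      exists! c : {ffun 'I_r -> K}, I (p - \sum_(j < r) c j *: e j).

(* The coefficient of t^i in the Hilbert series of S / I. See quotient_dim_gen,
   quotient_dim_uniq and hilbert_series_genP below: the number chosen exists and
   is unique. *)
Definition hilbert_series (K : fieldType) (n : nat) (I : {mpoly K[n]} -> Prop)
    (i : nat) : nat :=
  epsilon (inhabits 0%N) (quotient_dim I i).

(* The coefficient of t^i in the power series (1 - t^d)^m / (1 - t)^n, computed
   from 1 / (1 - t) = 1 + t + ... + t^i modulo t^(i+1). *)
Definition froberg_ratio (n m d i : nat) : int :=
  ((1 - 'X^d) ^+ m * (\sum_(j < i.+1) 'X^j) ^+ n : {poly int})`_i.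

Definition truncate_nonpos (c : nat -> int) (i : nat) : int :=
  if [forall j : 'I_i.+1, 0 < c j] then c i else 0.

Definition froberg_series (n m d : nat) : nat -> int :=
  truncate_nonpos (froberg_ratio n m d).

(* froberg_ratio n m d is the power series c with (1 - t)^n c = (1 - t^d)^m. *)
Lemma froberg_ratioP (n m d i : nat) :
  \sum_(j < i.+1) ((1 - 'X) ^+ n : {poly int})`_j * froberg_ratio n m d (i - j)
  = ((1 - 'X^d) ^+ m : {poly int})`_i.
Proof.
pose G N : {poly int} := \sum_(j < N) 'X^j.
have GE N : (1 - 'X) * G N = 1 - 'X^N.
  by rewrite -[1 - 'X]opprB mulNr -subrX1 opprB.
have expE N (a b : {poly int}) :
    exists q, (a + 'X^N * b) ^+ n = a ^+ n + 'X^N * q.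
  elim: n => [|k [q IH]]; first by exists 0; rewrite mulr0 addr0 !expr0.
  exists (b * (a ^+ k + 'X^N * q) + a * q).
  by rewrite !exprS IH; ring.
have stab k : (k <= i)%N ->
    froberg_ratio n m d k = ((1 - 'X^d) ^+ m * G i.+1 ^+ n)`_k.
  move=> ki; rewrite /froberg_ratio -/(G k.+1).
  have -> : G i.+1 = G k.+1 + 'X^(k.+1) * G (i - k)%N.
    rewrite /G -(subnKC ki) -addSn big_split_ord /= addKn big_distrr /=.
    by congr (_ + _); apply: eq_bigr => j _; rewrite exprD.
  have [q ->] := expE k.+1 (G k.+1) (G (i - k)%N).
  by rewrite mulrDr coefD mulrCA coefXnM ltnSn addr0.
transitivity ((1 - 'X) ^+ n * ((1 - 'X^d) ^+ m * G i.+1 ^+ n))`_i.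
  rewrite coefM; apply: eq_bigr => j _; congr (_ * _).
  exact: stab (leq_subr _ _).
rewrite mulrCA -exprMn GE -[- 'X^(i.+1)]mulrN1; have [q ->] := expE i.+1 1 (-1).
by rewrite mulrDr expr1n mulr1 coefD mulrCA coefXnM ltnSn addr0.
Qed.

Section QuotientDimension.

Variables (K : fieldType) (n m : nat) (f : 'I_m -> {mpoly K[n]}).

Lemma ideal_gen0 : ideal_gen f 0.
Proof. by exists (fun=> 0); rewrite big1 // => j _; rewrite mul0r. Qed.

Lemma ideal_genD p q : ideal_gen f p -> ideal_gen f q -> ideal_gen f (p + q).
Proof.
move=> [g ->] [h ->]; exists (fun j => g j + h j).
by rewrite -big_split /=; apply: eq_bigr => j _; rewrite mulrDl.
Qed.

Lemma ideal_genZ a p : ideal_gen f p -> ideal_gen f (a *: p).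
Proof.
move=> [g ->]; exists (fun j => a *: g j).
by rewrite scaler_sumr; apply: eq_bigr => j _; rewrite scalerAl.
Qed.

Lemma ideal_genB p q : ideal_gen f p -> ideal_gen f q -> ideal_gen f (p - q).
Proof. by move=> ? ?; rewrite -scaleN1r; apply/ideal_genD/ideal_genZ. Qed.

Lemma ideal_gen_sum (J : finType) (F : J -> {mpoly K[n]}) :
  (forall j, ideal_gen f (F j)) -> ideal_gen f (\sum_j F j).
Proof.
move=> IF; elim/big_ind: _ => //; [exact: ideal_gen0 | exact: ideal_genD].
Qed.

Lemma vspace_of_subspace (vT : vectType K) (P : vT -> Prop) :
    P 0 -> (forall u v, P u -> P v -> P (u + v)) ->
    (forall a u, P u -> P (a *: u)) ->
  exists V : {vspace vT}, forall v, v \in V <-> P v.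
Proof.
move=> P0 PD PZ.
suff max k : forall V : {vspace vT}, (\dim {:vT} - \dim V <= k)%N ->
    (forall v, v \in V -> P v) ->
    exists W : {vspace vT}, forall v, v \in W <-> P v.
  by apply: (max _ 0%VS (leqnn _)) => v; rewrite memv0 => /eqP->.
elim: k => [|k IHk] V dimV VP;
  case: (classic (forall v, P v -> v \in V)) => [PV|].
- by exists V => v; split; [apply: VP | apply: PV].
- case=> v _; suff -> : V = fullv by rewrite memvf.
  by apply/eqP; rewrite eqEdim subvf /= -subn_eq0 -leqn0.
- by exists V => v; split; [apply: VP | apply: PV].
move/not_all_ex_not => [v nPV]; have [Pv /negP vV] := imply_to_and _ _ nPV.
apply: (IHk (V + <[v]>)%VS) => [|w /memv_addP[u uV [x /vlineP[a ->] ->]]].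
  have ltV : (\dim V < \dim (V + <[v]>))%N.
    rewrite ltnNge; apply/negP => le_dim; case/negP: vV.
    have /eqP -> : V == (V + <[v]>)%VS by rewrite eqEdim addvSl.
    by rewrite memvE addvSr.
  by rewrite -ltnS (leq_trans _ dimV) // ltn_sub2l // (leq_trans ltV) ?dimvS
    ?subvf.
by apply: PD; [apply: VP | apply: PZ].
Qed.

Lemma quotient_dim_gen i : exists r, quotient_dim (ideal_gen f) i r.
Proof.
pose M := {mm : 'X_{1..n < i.+1} | mdeg mm == i}.
pose N := #|{: M}|.
pose mon (j : 'I_N) : 'X_{1..n} := val (val (enum_val j : M)).
pose form (v : 'rV[K]_N) : {mpoly K[n]} := \sum_j v 0 j *: 'X_[mon j].
have form0 : form 0 = 0.
  by rewrite /form big1 // => j _; rewrite mxE scale0r.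
have formD u v : form (u + v) = form u + form v.
  by rewrite -big_split; apply: eq_bigr => j _; rewrite mxE scalerDl.
have formZ a u : form (a *: u) = a *: form u.
  by rewrite scaler_sumr; apply: eq_bigr => j _; rewrite mxE scalerA.
have form_homog v : form v \is i.-homog.
  apply: rpred_sum => j _; apply: rpredZ; rewrite dhomogX /=.
  exact: (valP (enum_val j : M)).
have homog_form p : p \is i.-homog -> exists v, p = form v.
  move=> /dhomogP hp; exists (\row_j p@_(mon j)); apply/mpolyP => x.
  rewrite [RHS]raddf_sum /=.
  case: (boolP (mdeg x == i)) => [dx | ndx].
    have ltx : (mdeg x < i.+1)%N by rewrite (eqP dx).
    pose j := enum_rank (Sub (BMultinom ltx) dx : M).
    have monj : mon j = x by rewrite /mon /j enum_rankK.
    rewrite (bigD1 j) //= mcoeffZ mcoeffX mxE monj eqxx mulr1 big1 ?addr0 //.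
    move=> j' nj; rewrite mcoeffZ mcoeffX; case: eqP => [e|]; rewrite ?mulr0 //.
    case/eqP: nj; apply: enum_val_inj; apply/val_inj/val_inj.
    by rewrite /= -/(mon j') e -monj.
  rewrite big1 => [|j _].
    apply/eqP; rewrite mcoeff_eq0; apply: contra ndx => /hp /= ->; exact: eqxx.
  rewrite mcoeffZ mcoeffX; case: eqP => [e|]; rewrite ?mulr0 //.
  by case/negP: ndx; rewrite -e; apply: (valP (enum_val j : M)).
have [V VP] : exists V : {vspace 'rV[K]_N},
    forall v, v \in V <-> ideal_gen f (form v).
  apply: vspace_of_subspace => [|u v Iu Iv|a u Iu].
  - by rewrite form0; apply: ideal_gen0.
  - by rewrite formD; apply: ideal_genD.
  - by rewrite formZ; apply: ideal_genZ.
pose b := vbasis (V^C); exists (\dim (V^C)), (fun j => form b`_j) => // p.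
have form_sum (c : 'I_(\dim V^C) -> K) :
    \sum_j c j *: form b`_j = form (\sum_j c j *: b`_j).
  elim/big_rec2: _ => [|j y x _ ->]; first by rewrite form0.
  by rewrite formD formZ.
have formB u v : form (u - v) = form u - form v.
  by rewrite -scaleN1r formD formZ scaleN1r.
move=> /homog_form[v ->].
have : v \in (V + V^C)%VS by rewrite addv_complf memvf.
case/memv_addP => u uV [w wC ->].
exists [ffun j => coord b j w]; split=> [|c].
  under eq_bigr do rewrite ffunE.
  by rewrite form_sum -coord_vbasis // -formB addrK; apply/VP.
rewrite form_sum -formB => /VP; rewrite -addrA rpredDl // => cV.
have cC : \sum_j c j *: b`_j \in (V^C)%VS.
  apply: rpred_sum => j _; apply: rpredZ; apply: vbasis_mem.
  by rewrite mem_nth // size_tuple.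
have /eqP : w - \sum_j c j *: b`_j == 0.
  by rewrite -memv0 -(capv_compl V) memv_cap cV rpredB.
move/subr0_eq => ->; apply/ffunP => j; rewrite ffunE.
by rewrite coord_sum_free // (basis_free (vbasisP _)).
Qed.

Lemma quotient_dim_le i r s :
    quotient_dim (ideal_gen f) i r -> quotient_dim (ideal_gen f) i s ->
  (r <= s)%N.
Proof.
move=> [e he eP] [e' he' e'P].
have coefs j : exists c : {ffun 'I_s -> K},
    ideal_gen f (e j - \sum_k c k *: e' k).
  by have [c [Ic _]] := e'P _ (he j); exists c.
pose c j := sval (constructive_indefinite_description _ (coefs j)).
have cP j : ideal_gen f (e j - \sum_k c j k *: e' k).
  by rewrite /c; case: constructive_indefinite_description.
pose B : 'M[K]_(r, s) := \matrix_(j, k) c j k.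
suff /eqP <- : row_free B by apply: rank_leq_col.
rewrite -kermx_eq0; apply/rowV0P => v /sub_kermxP vB.
have [c0 [_ c0_uniq]] := eP 0 (rpred0 _).
have z1 : c0 = [ffun=> 0].
  apply: c0_uniq; rewrite big1 ?subr0 => [|j _]; first exact: ideal_gen0.
  by rewrite ffunE scale0r.
have z2 : c0 = [ffun j => v 0 j].
  apply: c0_uniq; rewrite sub0r -scaleN1r; apply: ideal_genZ.
  have -> : \sum_j [ffun j => v 0 j] j *: e j
      = \sum_j v 0 j *: (e j - \sum_k c j k *: e' k).
    under [RHS]eq_bigr do rewrite scalerBr scaler_sumr.
    rewrite sumrB exchange_big /= [X in _ - X]big1 ?subr0 => [|k _].
      by apply: eq_bigr => j _; rewrite ffunE.
    under eq_bigr do rewrite scalerA.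
    rewrite -scaler_suml; have /rowP/(_ k) := vB; rewrite !mxE => vBk.
    under eq_bigr => j _ do rewrite -[c j k](mxE matrix_key (fun j k => c j k)).
    by rewrite vBk scale0r.
  by apply: ideal_gen_sum => j; apply: ideal_genZ.
by apply/rowP => j; have /ffunP/(_ j) := etrans (esym z2) z1; rewrite !ffunE mxE.
Qed.

Lemma quotient_dim_uniq i r s :
    quotient_dim (ideal_gen f) i r -> quotient_dim (ideal_gen f) i s ->
  r = s.
Proof.
by move=> dr ds; apply/eqP; rewrite eqn_leq (quotient_dim_le dr ds)
  (quotient_dim_le ds dr).
Qed.

Lemma hilbert_series_genP i :
  quotient_dim (ideal_gen f) i (hilbert_series (ideal_gen f) i).
Proof. exact: epsilon_spec (quotient_dim_gen i). Qed.

End QuotientDimension.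

(* Main.v *)
(* Suppose that n + k general powers have the Froberg series.  Adding the powers
   one at a time, the dimensions of the quotients in degree i satisfy
   h_{j-1}(i) <= h_j(i) + h_{j-1}(i - d), while the coefficients of
   (1 - t^d)^j / (1 - t)^n satisfy this with equality and agree with h_0; hence,
   in the degrees where the predicted coefficients are positive, multiplication
   by each power is injective modulo the preceding ones.

   This fails for the (n + 2)-nd power.  The n + 2 forms are the points of a
   rational normal curve L(t) = \sum_k y_k \prod_{j != k} (t - b_j), and the
   residue theorem for L(t)^i / \prod_j (t - t_j)^(i - d + 1), the product being
   over the n + 2 parameters, is a syzygy of degree i between the powers, since
   every residue at t_j is divisible by L(t_j)^d.  With s = (n + 1) %/ 3 and
   i = (d - 1) s + d, the cofactor of the last power l'^d is, modulo l', a nonzero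
   multiple of tau^((d - 1) s) with tau the derivative of L at the last point.
   It is not in the ideal of the other n + 1 powers: mapping each of s disjoint
   triples of the n + 1 forms to multiples of a single variable z_j, with
   Lagrange weights, gives a ring morphism to K[z] that sends those powers into
   (z_j^d), l' to 0, and tau to \sum_j z_j.

   As i is about n (d - 1) / 3, it remains to see that the coefficients are
   positive up to a proportion 2/5 < 1/2 of n (d - 1).  They are k-th differences
   of the coefficients of (1 + ... + t^(d - 1))^(n + k), whose consecutive ratios
   stay below some rho < 1 and vary by O(1/n) in this range, so that they are
   approximately geometric. *)

Require Import Defs.
From mathcomp Require Import all_boot all_order all_algebra.
From mathcomp Require Import mpoly ring lra zify.
From Stdlib Require Import ClassicalEpsilon FunctionalExtensionality.
Set Implicit Arguments.
Unset Strict Implicit.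
Unset Printing Implicit Defensive.
Import Order.TTheory GRing.Theory Num.Theory.
Local Open Scope ring_scope.

(** * Coefficients of powers of 1 + X + ... + X^(d - 1) *)

Section PowerOfInterval.

Variable R : realFieldType.

(** The case [v = u + 1] is the usual inequality. Allowing all [u <= v] also excludes internal zeros
    of a nonnegative sequence, and it is this form that window sums preserve. *)
Definition log_concave (b : int -> R) : Prop :=
  forall u v, u <= v -> b u * b (v + 1) <= b (u + 1) * b v.

Lemma log_concave_spread b u w x y :
  log_concave b -> u <= x -> u <= y -> u + w = x + y -> b u * b w <= b x * b y.
Proof.
move=> lcb.
have main : forall (t : nat) u y, u + t%:Z <= y ->
    b u * b (y + t%:Z) <= b (u + t%:Z) * b y.
  elim=> [|t IH] {}u {}y h; first by rewrite !addr0.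
  have := IH (u + 1) y; have -> : u + 1 + t%:Z = u + t.+1%:Z by lia.
  move=> /(_ h); apply: le_trans.
  have -> : y + t.+1%:Z = (y + t%:Z) + 1 by lia.
  by apply: lcb; lia.
wlog xy : x y / x <= y => [H ux uy e|ux _ e].
  case: (leP x y) => [/H|/ltW /H]; first exact.
  by rewrite [b x * _]mulrC; apply => //; rewrite e addrC.
have := main `|x - u|%N u y.
have -> : u + `|x - u|%N%:Z = x by lia.
have -> : y + `|x - u|%N%:Z = w by lia.
exact.
Qed.

Definition window_sum (d : nat) (b : int -> R) (z : int) : R :=
  \sum_(c < d) b (z - c%:Z).

(** The coefficients of [(1 + X + ... + X^(d - 1))^m], as [interval_powE] shows. Indexing by [int]
    makes them vanish below zero, so that shifts need no side condition. *)
Fixpoint interval_pow (d m : nat) : int -> R :=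
  if m is m'.+1 then window_sum d (interval_pow d m')
  else fun z => (z == 0)%:R.

Lemma interval_pow_ge0 d m z : 0 <= interval_pow d m z.
Proof.
elim: m z => [|m IH] z /=; first exact: ler0n.
by apply: sumr_ge0 => c _; apply: IH.
Qed.

(** The windows ending at [z] and at [z + 1] differ by one end term each. After the common product
    [V * U] cancels, the three remaining products on each side are compared one by one with
    [log_concave_spread]. *)
Lemma window_sum_log_concave d b :
  log_concave b -> log_concave (window_sum d b).
Proof.
move=> lcb; case: d => [|d] u v uv; first by rewrite /window_sum !big_ord0 mul0r.
pose V := \sum_(c < d) b (u - c%:Z); pose U := \sum_(c < d) b (v - c%:Z).
have eL z : window_sum d.+1 b z = \sum_(c < d) b (z - c%:Z) + b (z - d%:Z).
  by rewrite /window_sum big_ord_recr.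
have eR z : window_sum d.+1 b (z + 1) = b (z + 1) + \sum_(c < d) b (z - c%:Z).
  rewrite /window_sum big_ord_recl subr0; congr (_ + _).
  by apply: eq_bigr => c _; congr b; rewrite lift0; lia.
rewrite [window_sum _ _ u]eL [window_sum _ _ v]eL !eR -/U -/V.
have h1 : V * b (v + 1) <= b (u + 1) * U.
  rewrite mulr_suml mulr_sumr; apply: ler_sum => c _.
  by apply: (log_concave_spread lcb); lia.
have h2 : b (u - d%:Z) * b (v + 1) <= b (u + 1) * b (v - d%:Z).
  by apply: (log_concave_spread lcb); lia.
have h3 : b (u - d%:Z) * U <= V * b (v - d%:Z).
  rewrite mulr_suml mulr_sumr; apply: ler_sum => c _.
  by apply: (log_concave_spread lcb) => //; have := ltn_ord c; lia.
lra.
Qed.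

Lemma interval_pow_log_concave d m : log_concave (interval_pow d m).
Proof.
elim: m => [|m IH] /=; last exact: window_sum_log_concave.
move=> u v uv /=; case: (eqVneq (v + 1) 0) => [v0|_].
  by case: eqVneq => [|_]; [lia | rewrite mul0r mulr_ge0 ?ler0n].
by rewrite mulr0 mulr_ge0 ?ler0n.
Qed.

(* j / m is the mean of one of m digits in [0, d) that add up to j. *)
Lemma interval_pow_mean d m z :
  z%:~R * interval_pow d m.+1 z
  = m.+1%:R * \sum_(c < d) c%:R * interval_pow d m (z - c%:Z).
Proof.
elim: m z => [|m IH] z.
  rewrite mul1r [interval_pow d 1 z]/= /window_sum mulr_sumr; apply: eq_bigr => c _ /=.
  case: eqVneq => [e|]; last by rewrite !mulr0.
  by have -> : z = c%:Z by lia.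
have -> : interval_pow d m.+2 z = window_sum d (interval_pow d m.+1) z by [].
rewrite mulr_sumr.
transitivity (\sum_(c < d)
    (m.+1%:R * \sum_(c' < d) c'%:R * interval_pow d m (z - c%:Z - c'%:Z)
    + c%:R * interval_pow d m.+1 (z - c%:Z))).
  apply: eq_bigr => c _; rewrite -IH -mulrDl; congr (_ * _).
  by rewrite intrB subrK.
rewrite big_split /= -mulr_sumr exchange_big /= -[m.+2%:R]natr1 mulrDl mul1r.
congr (_ * _ + _); apply: eq_bigr => c _; rewrite -mulr_sumr; congr (_ * _).
by apply: eq_bigr => c' _; congr interval_pow; lia.
Qed.


(** By [interval_pow_mean] the right side is a double sum over digits [c], [c'] of
    [(c - c') b(z + 1 - c) b(z - c')]. Symmetrized in [c] and [c'], its terms are nonnegative by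
    log-concavity, and the pair of digits [1], [0] alone contributes the left side. *)
Lemma interval_pow_log_concave_defect d m z : (1 < d)%N ->
  interval_pow d m z ^+ 2 - interval_pow d m (z + 1) * interval_pow d m (z - 1)
  <= interval_pow d m.+1 z * interval_pow d m.+1 (z + 1) / m.+1%:R.
Proof.
move=> d1; set b := interval_pow d m.
pose B1 z := \sum_(c < d) c%:R * b (z - c%:Z).
have meanE x : B1 x = x%:~R * interval_pow d m.+1 x / m.+1%:R.
  by rewrite interval_pow_mean mulrC mulKf // pnatr_eq0.
have BE x : interval_pow d m.+1 x = \sum_(c < d) b (x - c%:Z) by [].
have -> : interval_pow d m.+1 z * interval_pow d m.+1 (z + 1) / m.+1%:R
    = B1 (z + 1) * interval_pow d m.+1 z - interval_pow d m.+1 (z + 1) * B1 z.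
  have : m.+1%:R != 0 :> R by rewrite pnatr_eq0.
  by rewrite !meanE intrD; move: m.+1%:R => M M0; field.
pose T (p : 'I_d * 'I_d) := (p.1%:R - p.2%:R) * (b (z + 1 - p.1%:Z) * b (z - p.2%:Z)).
have -> : B1 (z + 1) * interval_pow d m.+1 z - interval_pow d m.+1 (z + 1) * B1 z
    = \sum_p T p.
  rewrite !BE -(pair_bigA _ (fun x y => T (x, y))) /= !big_distrlr -sumrB /=.
  apply: eq_bigr => c _; rewrite -sumrB; apply: eq_bigr => c' _; rewrite /T /=; ring.
pose sw (p : 'I_d * 'I_d) := (p.2, p.1).
have swK : involutive sw by case.
have T0 p : 0 <= T p + T (sw p).
  have -> : T p + T (sw p) = (p.1%:R - p.2%:R)
      * (b (z + 1 - p.1%:Z) * b (z - p.2%:Z) - b (z + 1 - p.2%:Z) * b (z - p.1%:Z)).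
    by rewrite /T /=; ring.
  case: (leqP p.1 p.2) => h.
    rewrite mulr_le0 ?subr_le0 ?ler_nat // mulrC.
    by apply: (log_concave_spread (@interval_pow_log_concave d m)); lia.
  rewrite mulr_ge0 ?subr_ge0 ?ler_nat 1?ltnW // mulrC.
  by apply: (log_concave_spread (@interval_pow_log_concave d m)); lia.
have e2 : 2 * (\sum_p T p) = \sum_p (T p + T (sw p)).
  rewrite big_split /= mulr2n mulrDl mul1r; congr (_ + _).
  by rewrite (reindex_inj (inv_inj swK)).
pose i0 : 'I_d := Ordinal (ltnW d1); pose i1 : 'I_d := Ordinal d1.
rewrite -(@ler_pM2l _ 2) // e2 (bigD1 (i1, i0)) //= (bigD1 (i0, i1)) //= addrA.
have rest : 0 <= \sum_(i | (i != (i1, i0)) && (i != (i0, i1))) (T i + T (sw i)).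
  by apply: sumr_ge0 => p _; apply: T0.
rewrite /T /= subr0 !sub0r !mul1r !mulN1r in rest *.
have <- : z = z + 1 - 1 :> int by lia.
rewrite !addr0 /=.
rewrite -/b; lra.
Qed.

(** Weights that lose at most a ninth over the whole range have mean above [4 / 9 * D]. The terms
    [c] and [D - c] are paired: the larger index has at least [8 / 9] of the weight of the smaller
    one, and [8 / 9] exceeds [17 / 9 * 4 / 9]. *)
Lemma sum_gt0_of_mean (D : nat) (P : nat -> R) (delta y : R) :
  0 <= delta <= 1 -> 8 / 9 <= (1 - delta) ^+ D -> y < 4 / 9 * D%:R ->
  (forall c, 0 <= P c) -> (forall c, (c < D)%N -> (1 - delta) * P c <= P c.+1) ->
  0 < P D -> 0 < \sum_(c < D.+1) (c%:R - y) * P c.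
Proof.
move=> /andP[d0 d1] dD yD P0 Pr PD.
have chain c t : (c + t <= D)%N -> 8 / 9 * P c <= P (c + t)%N.
  move=> ct; apply: (@le_trans _ _ ((1 - delta) ^+ t * P c)).
    apply: ler_wpM2r => //; apply: (le_trans dD).
    by apply: ler_wiXn2l; rewrite ?subr_ge0 //; [lra | lia].
  elim: t ct => [|t IH] ct; first by rewrite mul1r addn0.
  rewrite addnS exprS -mulrA; apply: le_trans (Pr _ _); last lia.
  by apply: ler_wpM2l; [rewrite subr_ge0 | apply: IH; lia].
pose T c := (c%:R - y) * P c.
have tw c c' : (c <= c')%N -> (c + c' = D)%N -> 0 <= T c + T c'.
  move=> cc' cD; have := chain c (c' - c)%N.
  rewrite subnKC // => /(_ ltac:(lia)) ch.
  have eD : D%:R = c%:R + c'%:R :> R by rewrite -natrD cD.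
  have le : (c%:R : R) <= c'%:R by rewrite ler_nat.
  have c0 : 0 <= (c%:R : R) by [].
  have h1 : 0 <= (c'%:R - y) * (P c' - 8 / 9 * P c) by apply: mulr_ge0; lra.
  have h2 : 0 <= (c%:R - y + 8 / 9 * (c'%:R - y)) * P c.
    apply: mulr_ge0 => //; lra.
  rewrite /T; lra.
have twl c : (c <= D)%N -> 0 <= T c + T (D - c)%N.
  move=> cD; case: (leqP c (D - c)) => h; first by apply: tw; lia.
  by rewrite addrC; apply: tw; lia.
rewrite -(@pmulr_rgt0 _ 2) //.
have -> : 2 * (\sum_(c < D.+1) (c%:R - y) * P c) = \sum_(c < D.+1) (T c + T (D - c)%N).
  rewrite big_split /= mulr2n mulrDl mul1r; congr (_ + _).
  by rewrite (reindex_inj rev_ord_inj); apply: eq_bigr => c _; rewrite /= subSS.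
rewrite (bigD1 ord0) //= ltr_wpDr //.
  by apply: sumr_ge0 => c _; apply: twl; rewrite -ltnS.
have D0 : 0 <= (D%:R : R) by [].
have := chain 0%N D (leqnn _); rewrite add0n subn0 /T => ch.
have := P0 0%N; rewrite le_eqVlt => /orP[/eqP <-|P0_gt0].
  by rewrite mulr0 add0r mulr_gt0 //; lra.
have h1 : 0 <= (D%:R - y) * (P D - 8 / 9 * P 0%N) by apply: mulr_ge0; lra.
have h2 : 0 < (8 / 9 * D%:R - 17 / 9 * y) * P 0%N by apply: mulr_gt0; lra.
lra.
Qed.

(** Otherwise log-concavity makes all ratios [b (x - 1) / b x] with [x >= z] at least [1 - delta]. A
    digit among [m + 1] adding up to [z + D - 1] is then nearly uniform or biased upwards, so its
    mean exceeds [4 / 9 * D]; but by [interval_pow_mean] this mean is [(z + D - 1) / (m + 1)]. *)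
Lemma interval_pow_ratio_lt1 D m z : (0 < D)%N ->
  (z + D%:Z - 1)%:~R < 4 / 9 * D%:R * m.+1%:R :> R ->
  interval_pow D.+1 m (z - 1) <= (1 - (9 * D%:R)^-1) * interval_pow D.+1 m z.
Proof.
move=> D0 zlt; set b := interval_pow D.+1 m.
pose delta : R := (9 * D%:R)^-1; rewrite -/delta.
have Dr : 1 <= (D%:R : R) by rewrite ler1n.
have delta0 : 0 < delta by rewrite invr_gt0; lra.
have dD : delta * D%:R = 1 / 9.
  by move: Dr; rewrite /delta; move: D%:R => x x1; field; lra.
have {}dD : delta <= 1 / 9 /\ delta * D%:R <= 1 / 9.
  by rewrite -[X in X <= _ /\ _]mulr1 -dD; split; rewrite // ler_pM2l.
move: delta dD delta0 => delta [delta1 dD] delta0.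
rewrite leNgt; apply/negP => bz.
(* Bernoulli's inequality, with [delta * D] at most [1 / 9]. *)
have bern : 8 / 9 <= (1 - delta) ^+ D.
  have : 1 - D%:R * delta <= (1 - delta) ^+ D.
    elim: (D) => [|k IH]; first by rewrite mul0r subr0.
    rewrite exprS -natr1.
    have : (1 - delta) * (1 - k%:R * delta) <= (1 - delta) * (1 - delta) ^+ k.
      by apply: ler_wpM2l => //; lra.
    have : 0 <= k%:R * delta * delta by rewrite !mulr_ge0 // ltW.
    lra.
  lra.
have bge x : 0 <= b x by apply: interval_pow_ge0.
have bz0 : 0 < b (z - 1) by apply: le_lt_trans bz; rewrite mulr_ge0 // subr_ge0; lra.
pose y := (z + D%:Z - 1)%:~R / m.+1%:R : R.
have m0 : 0 < m.+1%:R :> R by [].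
suff : 0 < \sum_(c < D.+1) (c%:R - y) * b (z + D%:Z - 1 - c%:Z).
  have -> : \sum_(c < D.+1) (c%:R - y) * b (z + D%:Z - 1 - c%:Z)
      = \sum_(c < D.+1) c%:R * b (z + D%:Z - 1 - c%:Z)
        - y * interval_pow D.+1 m.+1 (z + D%:Z - 1).
    by rewrite mulr_sumr -sumrB; apply: eq_bigr => c _; rewrite mulrBl.
  suff -> : y * interval_pow D.+1 m.+1 (z + D%:Z - 1)
      = \sum_(c < D.+1) c%:R * b (z + D%:Z - 1 - c%:Z) by rewrite subrr ltxx.
  by rewrite /y mulrAC interval_pow_mean mulrC mulKf // gt_eqF.
apply: (@sum_gt0_of_mean D (fun c => b (z + D%:Z - 1 - c%:Z)) delta) => //.
- by apply/andP; split; lra.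
- by rewrite ltr_pdivrMr.
- move=> c cD /=.
  have -> : z + D%:Z - 1 - c.+1%:Z = z + D%:Z - 1 - c%:Z - 1 by clear; lia.
  set x := z + D%:Z - 1 - c%:Z.
  have zx : z <= x by rewrite /x; clear -cD; lia.
  have lc : b (z - 1) * b x <= b z * b (x - 1).
    by apply: (log_concave_spread (@interval_pow_log_concave _ _)); clear -zx; lia.
  have lt : (1 - delta) * b z * b x <= b (z - 1) * b x.
    by apply: ler_wpM2r => //; apply: ltW.
  have := bge z; rewrite le_eqVlt => /orP[/eqP bz_eq0|bz_gt0].
    suff -> : b x = 0 by rewrite mulr0.
    apply/eqP; rewrite eq_le bge andbT -(pmulr_rle0 _ bz0).
    by rewrite (le_trans lc) // -bz_eq0 mul0r.
  rewrite -(ler_pM2l bz_gt0); apply: le_trans lc; apply: le_trans lt.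
  by rewrite mulrCA mulrA.
- by have -> : z + D%:Z - 1 - D%:Z = z - 1 by clear; lia.
Qed.

(** * Iterated differences of approximately geometric sequences *)

Definition nabla (V : zmodType) (c : nat -> V) : nat -> V := fun l => c l - c l.+1.

Lemma iter_nablaD (c w : nat -> R) (x : R) k l :
  iter k (@nabla R) (fun l => x * c l + w l) l
  = x * iter k (@nabla R) c l + iter k (@nabla R) w l.
Proof.
elim: k l => [|k IH] l //=.
by rewrite /nabla !IH; ring.
Qed.

Lemma norm_iter_nabla (w : nat -> R) (e : R) k :
  (forall l, (l <= k)%N -> `|w l| <= e) -> `|iter k (@nabla R) w 0| <= 2 ^+ k * e.
Proof.
move=> we; suff main j l : (j + l <= k)%N -> `|iter j (@nabla R) w l| <= 2 ^+ j * e.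
  by apply: main; rewrite addn0.
elim: j l => [|j IH] l jl; first by rewrite mul1r we.
rewrite iterS /nabla (le_trans (ler_normB _ _)) //.
have := IH l ltac:(lia); have := IH l.+1 ltac:(lia).
by rewrite exprS; lra.
Qed.

(** With [w l = r * c l - c l.+1], one difference of [c] is [(1 - r) * c + w]. Each of the [k]
    differences thus gives a factor [1 - r] and an error, and further differences at most double an
    error each time. *)
Lemma iter_nabla_geometric (c : nat -> R) (r e : R) k :
  0 <= r <= 1 -> 0 <= e ->
  (forall l, (l < k)%N -> 0 <= r * c l - c l.+1 <= e) ->
  (1 - r) ^+ k * c 0%N - (k * 2 ^ k)%:R * e <= iter k (@nabla R) c 0%N.
Proof.
move=> /andP[r0 r1] e0; elim: k => [|k IH] ce.
  by rewrite mul1r mul0n mul0r subr0.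
have {}IH := IH (fun l lk => ce l (ltnW lk)).
pose w l := r * c l - c l.+1.
have wle : `|iter k (@nabla R) w 0| <= 2 ^+ k * e.
  apply: norm_iter_nabla => l lk; have /andP[w0 we] := ce l lk.
  by rewrite ger0_norm.
rewrite iterSr.
have -> : nabla c = fun l => (1 - r) * c l + w l.
  by apply: functional_extensionality => l; rewrite /nabla /w; ring.
rewrite iter_nablaD.
have h1 : (1 - r) * ((1 - r) ^+ k * c 0%N - (k * 2 ^ k)%:R * e)
    <= (1 - r) * iter k (@nabla R) c 0 by apply: ler_wpM2l => //; lra.
have h2 : - (2 ^+ k * e) <= iter k (@nabla R) w 0.
  by move: wle; rewrite ler_norml => /andP[].
have h3 : 0 <= r * ((k * 2 ^ k)%:R * e) by rewrite !mulr_ge0.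
have h4 : 0 <= (k * 2 ^ k)%:R * e by rewrite mulr_ge0.
have h5 : 0 <= 2 ^+ k * e by rewrite mulr_ge0 ?exprn_ge0.
have -> : (k.+1 * 2 ^ k.+1)%:R * e = 2 * ((k * 2 ^ k)%:R * e) + 2 * (2 ^+ k * e).
  by rewrite expnS -natrX -[k.+1]addn1 !natrM natrD; ring.
rewrite exprS; lra.
Qed.

(** The last hypothesis says that the ratio [c l.+1 / c l] decreases with [l], by at most [e] per
    step. The ratios thus stay between [r - k * e] and [r], and [iter_nabla_geometric] applies with
    error [k * e * c 0]. *)
Lemma iter_nabla_log_concave (c : nat -> R) (r e : R) k :
  (forall l, 0 <= c l) -> (forall l, c l.+1 <= c l) ->
  0 < c 0%N -> c 1%N = r * c 0%N -> r <= 1 -> 0 <= e ->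
  (forall l, (l < k)%N -> c l * c l.+2 <= c l.+1 ^+ 2
     <= c l * c l.+2 + e * (c l * c l.+1)) ->
  (1 - r) ^+ k * c 0%N - (k * 2 ^ k)%:R * (k%:R * e * c 0%N)
    <= iter k (@nabla R) c 0%N.
Proof.
move=> c0 mono c0_gt0 c1 r1 e0 lc.
have r0 : 0 <= r by rewrite -(pmulr_lge0 _ c0_gt0) -c1.
apply: iter_nabla_geometric; [by rewrite r0 | by rewrite !mulr_ge0 | ].
suff main l : (l < k)%N -> [/\ c l <= c 0%N, c l.+1 <= r * c l
    & r * c l <= c l.+1 + l%:R * e * c l].
  move=> l lk; have [h1 h2 h3] := main l lk.
  rewrite subr_ge0 h2 /= lerBlDl (le_trans h3) // lerD2l.
  apply: ler_pM => //; first by rewrite mulr_ge0.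
  by apply: ler_wpM2r => //; rewrite ler_nat ltnW.
elim: l => [|l IH] lk; first by rewrite c1; split=> //; lra.
have [h1 h2 h3] := IH (ltnW lk); have /andP[lc1 lc2] := lc l (ltnW lk).
have [cl0|cl_gt0] : c l.+1 = 0 \/ 0 < c l.+1.
  by have := c0 l.+1; rewrite le_eqVlt => /orP[/eqP <-|]; [left | right].
  have -> : c l.+2 = 0 by apply/eqP; rewrite eq_le c0 -{1}cl0 mono.
  by rewrite cl0 !mulr0 addr0 ltW.
have cl_gt0' := lt_le_trans cl_gt0 (mono l).
split; first exact: le_trans (mono l) h1.
- rewrite -(ler_pM2l cl_gt0') (le_trans lc1) //.
  have := ler_wpM2r (c0 l.+1) h2; rewrite expr2; lra.
- rewrite -(ler_pM2l cl_gt0').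
  have : c l.+1 * (r * c l) <= c l.+1 * (c l.+1 + l%:R * e * c l) by rewrite ler_pM2l.
  rewrite -natr1; move: lc2; rewrite expr2; lra.
Qed.

Lemma interval_pow_lt0 d m z : z < 0 -> interval_pow d m z = 0.
Proof.
elim: m z => [|m IH] z z0 /=; first by case: eqVneq z0 => // ->.
by rewrite /window_sum big1 // => c _; apply: IH; lia.
Qed.

Lemma interval_pow0 D m : interval_pow D.+1 m 0 = 1.
Proof.
elim: m => [|m IH] //=; rewrite /window_sum big_ord_recl subr0 IH big1 ?addr0 //.
by move=> c _; rewrite interval_pow_lt0 // lift0; lia.
Qed.

Lemma interval_pow_le D m z x : (0 < D)%N -> x <= z ->
  (z + D%:Z - 1)%:~R < 4 / 9 * D%:R * m.+1%:R :> R ->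
  interval_pow D.+1 m x <= interval_pow D.+1 m z.
Proof.
move=> D0 xz; have [t ->] : exists t : nat, x = z - t%:Z.
  by exists `|z - x|%N; lia.
elim: t z {x xz} => [|t IH] z zlt; first by rewrite subr0.
have -> : z - t.+1%:Z = z - 1 - t%:Z by clear; lia.
apply: (@le_trans _ _ (interval_pow D.+1 m (z - 1))).
  by apply: IH; apply: le_lt_trans zlt; rewrite ler_int; clear; lia.
apply: (le_trans (interval_pow_ratio_lt1 D0 zlt)).
rewrite ler_piMl ?interval_pow_ge0 // lerBlDr lerDl invr_ge0 mulr_ge0 //.
Qed.

Lemma iter_nabla_interval_pow_gt0 D k : (0 < D)%N ->
  exists n0 : nat, forall n j : nat, (n0 <= n)%N -> (5 * j <= 2 * D * n)%N ->
    0 < iter k (@nabla R) (fun l => interval_pow D.+1 (n + k) (j%:Z - l%:Z)) 0%N.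
Proof.
(* The first summand absorbs the additive [D] in the gap between [2 / 5] and [4 / 9]. The second
   makes the error [k * 2 ^ k * k * e] smaller than [(9 * D) ^ -k], a lower bound for
   [(1 - r) ^ k]. *)
move=> D0; exists (23 + k * 2 ^ k * k * D.+1 ^ 2 * (9 * D) ^ k)%N => n j n_ge jn.
set m := (n + k)%N; set c := fun l : nat => _.
have Dr : 1 <= (D%:R : R) by rewrite ler1n.
have bound : (j%:Z + D%:Z - 1)%:~R < 4 / 9 * D%:R * m.+1%:R :> R.
  have : (45 * (j + D) <= 20 * D * m.+1)%N by rewrite /m; nia.
  rewrite -(ler_nat R) !natrM natrD intrB intrD /=; lra.
have ge0 z : 0 <= interval_pow D.+1 m z by apply: interval_pow_ge0.
have mono z : z + 1 <= j%:Z -> interval_pow D.+1 m z <= interval_pow D.+1 m (z + 1).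
  move=> zj; apply: interval_pow_le => //; first by rewrite lerDl.
  by apply: le_lt_trans bound; rewrite ler_int; lia.
have c0_gt0 : 0 < c 0%N.
  apply: (@lt_le_trans _ _ 1) => //.
  rewrite -(interval_pow0 D m).
  by apply: interval_pow_le; rewrite ?subr0.
(* The log-concavity defect is at most a product of two window sums over [m + 1]. In the increasing
   range each window sum is at most [D + 1] times its top term, whence the square. *)
pose r := c 1%N / c 0%N; pose e := D.+1%:R ^+ 2 / m.+1%:R : R.
have e0 : 0 <= e by rewrite divr_ge0 ?exprn_ge0.
have rle : r <= 1 - (9 * D%:R)^-1.
  by rewrite ler_pdivrMr // /c subr0; apply: interval_pow_ratio_lt1.
have delta0 : 0 < (9 * D%:R)^-1 :> R by rewrite invr_gt0; lra.
have main : (1 - r) ^+ k * c 0%N - (k * 2 ^ k)%:R * (k%:R * e * c 0%N)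
    <= iter k (@nabla R) c 0%N.
  apply: iter_nabla_log_concave => //.
  - by move=> l; apply: ge0.
  - move=> l; rewrite /c; have -> : j%:Z - l%:Z = j%:Z - l.+1%:Z + 1 by clear; lia.
    by apply: mono; clear; lia.
  - by rewrite divfK // gt_eqF.
  - lra.
  - move=> l lk; rewrite /c.
    set z := j%:Z - l.+1%:Z.
    have -> : j%:Z - l%:Z = z + 1 by rewrite /z; clear; lia.
    have -> : j%:Z - l.+2%:Z = z - 1 by rewrite /z; clear; lia.
    have := @interval_pow_log_concave D.+1 m (z - 1) z ltac:(clear; lia).
    rewrite subrK mulrC => lc; rewrite lc /=.
    have := @interval_pow_log_concave_defect D.+1 m z D0.
    have win x : x <= j%:Z -> interval_pow D.+1 m.+1 x <= D.+1%:R * interval_pow D.+1 m x.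
      move=> xj /=; rewrite mulr_natl -[X in _ *+ X](card_ord D.+1) -sumr_const.
      apply: ler_sum => a _; apply: interval_pow_le => //.
        by clear; lia.
      by apply: le_lt_trans bound; rewrite ler_int; clear -xj; lia.
    have wz := win z ltac:(rewrite /z; clear; lia).
    have wz1 := win (z + 1) ltac:(rewrite /z; clear; lia).
    rewrite -lerBlDl [_ * interval_pow _ _ (z - 1)]mulrC => /le_trans; apply.
    rewrite /e [leRHS]mulrAC; apply: ler_wpM2r; first by rewrite invr_ge0.
    have := ler_pM (interval_pow_ge0 _ _ _) (interval_pow_ge0 _ _ _) wz wz1.
    by move=> /le_trans; apply; rewrite expr2; lra.
apply: lt_le_trans main.
have h1 : (9 * D%:R)^-1 ^+ k <= (1 - r) ^+ k by apply: lerXn2r; rewrite ?nnegrE; lra.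
have -> : (1 - r) ^+ k * c 0%N - (k * 2 ^ k)%:R * (k%:R * e * c 0%N)
  = ((1 - r) ^+ k - (k * 2 ^ k * k)%:R * e) * c 0%N by rewrite !natrM; ring.
apply: mulr_gt0 => //; rewrite subr_gt0; apply: lt_le_trans h1.
have nD0 : 0 < ((9 * D) ^ k)%:R :> R by rewrite ltr0n expn_gt0; lia.
have -> : (9 * D%:R)^-1 ^+ k = ((9 * D) ^ k)%:R^-1 :> R by rewrite natrX natrM exprVn.
rewrite /e mulrA ltr_pdivrMr // ltr_pdivlMl //.
by rewrite -!natrX -!natrM ltr_nat /m; lia.
Qed.

End PowerOfInterval.

(** * Positivity of the predicted series *)

Lemma expr_add_mul (S : comNzRingType) (a b x : S) m :
  exists q, (a + x * b) ^+ m = a ^+ m + x * q.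
Proof.
elim: m => [|m [q IH]]; first by exists 0; rewrite mulr0 addr0 !expr0.
by exists (b * (a ^+ m + x * q) + a * q); rewrite !exprS IH; ring.
Qed.

Section FrobergRatio.

Lemma froberg_ratioE N n m d i : (i < N)%N ->
  froberg_ratio n m d i
  = ((1 - 'X^d) ^+ m * (\sum_(j < N) 'X^j) ^+ n : {poly int})`_i.
Proof.
move=> iN; rewrite /froberg_ratio -(subnKC iN) big_split_ord /=.
have -> : \sum_(j < N - i.+1) 'X^(i.+1 + j)
    = 'X^(i.+1) * \sum_(j < N - i.+1) 'X^j :> {poly int}.
  by rewrite mulr_sumr; apply: eq_bigr => j _; rewrite exprD.
have [q ->] := expr_add_mul (\sum_(j < i.+1) 'X^j)
  (\sum_(j < N - i.+1) 'X^j) ('X^(i.+1) : {poly int}) n.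
by rewrite mulrDr coefD mulrCA coefXnM ltnSn addr0.
Qed.

Lemma froberg_ratioS n m d i :
  froberg_ratio n m.+1 d i
  = froberg_ratio n m d i - (if (d <= i)%N then froberg_ratio n m d (i - d) else 0).
Proof.
rewrite {1}/froberg_ratio exprS -mulrA mulrBl mul1r coefB coefXnM.
case: ltnP => di /=; first by rewrite subr0.
by rewrite (@froberg_ratioE i.+1 n m d (i - d)) // ltnS leq_subr.
Qed.

(** Each [1 - t^d] is [(1 - t) (1 + ... + t^(d - 1))], and [n] of the [n + k] factors [1 - t] cancel
    the denominator. The truncated geometric sums leave a factor [(1 - t^(i + 1))^n], invisible in
    degree [i]. *)
Lemma froberg_ratio_diff n k d i :
  froberg_ratio n (n + k) d i
  = ((1 - 'X) ^+ k * (\sum_(c < d) 'X^c) ^+ (n + k) : {poly int})`_i.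
Proof.
have GE N : (1 - 'X) * (\sum_(j < N) 'X^j) = 1 - 'X^N :> {poly int}.
  by rewrite -[1 - 'X]opprB mulNr -subrX1 opprB.
rewrite /froberg_ratio.
have -> : (1 - 'X^d) ^+ (n + k) * (\sum_(j < i.+1) 'X^j) ^+ n
   = (1 - 'X) ^+ k * (\sum_(c < d) 'X^c) ^+ (n + k) * (1 - 'X^(i.+1)) ^+ n :> {poly int}.
  by rewrite -!GE !exprMn exprD; ring.
rewrite -[- 'X^(i.+1)]mulrN1.
have [q ->] := expr_add_mul 1 (-1) ('X^(i.+1) : {poly int}) n.
by rewrite mulrDr expr1n mulr1 coefD mulrCA coefXnM ltnSn addr0.
Qed.

Definition coefz (R : nzRingType) (p : {poly R}) (z : int) : R :=
  if z is Posz l then p`_l else 0.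

Lemma coefz_mulXn (R : nzRingType) (p : {poly R}) c z :
  coefz ('X^c * p) z = coefz p (z - c%:Z).
Proof.
case: z => z /=; last by have -> : Negz z - c%:Z = Negz (z + c) by lia.
rewrite coefXnM; case: ltnP => zc.
  by have -> : z%:Z - c%:Z = Negz (c - z).-1 by lia.
by have -> : z%:Z - c%:Z = (z - c)%N by lia.
Qed.

Lemma coefzB (R : nzRingType) (p q : {poly R}) z :
  coefz (p - q) z = coefz p z - coefz q z.
Proof. by case: z => z /=; rewrite ?coefB ?subr0. Qed.

Lemma interval_powE (R : realFieldType) d m z :
  interval_pow R d m z = coefz ((\sum_(c < d) 'X^c) ^+ m : {poly R}) z.
Proof.
elim: m z => [|m IH] z /=.
  by case: z => z //=; rewrite coef1 -[z%:Z == 0]/(z == 0%N)%N.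
transitivity (\sum_(c < d) coefz ('X^c * (\sum_(c < d) 'X^c) ^+ m : {poly R}) z).
  by apply: eq_bigr => c _; rewrite IH coefz_mulXn.
rewrite exprS mulr_suml.
by case: z => z /=; rewrite ?coef_sum // big1.
Qed.

(** Since [l] counts downwards from degree [z], each [nabla] is a multiplication by [1 - X]. *)
Lemma iter_nabla_coefz (R : realFieldType) (p : {poly R}) k (z : int) :
  iter k (@nabla R) (fun l => coefz p (z - l%:Z)) 0%N = coefz ((1 - 'X) ^+ k * p) z.
Proof.
suff -> : iter k (@nabla R) (fun l => coefz p (z - l%:Z))
    = fun l => coefz ((1 - 'X) ^+ k * p) (z - l%:Z) by rewrite subr0.
elim: k => [|k IH]; first by rewrite mul1r.
rewrite iterS IH; apply: functional_extensionality => l.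
rewrite /nabla exprS -mulrA mulrBl mul1r coefzB -['X in RHS]expr1 coefz_mulXn.
by congr (_ - coefz _ _); lia.
Qed.

Lemma froberg_ratio_gt0 k d : (1 < d)%N ->
  exists n0 : nat, forall n j : nat, (n0 <= n)%N -> (5 * j <= 2 * d.-1 * n)%N ->
    0 < froberg_ratio n (n + k) d j.
Proof.
case: d => [|D] // D0; have [n0 pos] := @iter_nabla_interval_pow_gt0 rat D k D0.
exists n0 => n j nn0 jn; have := pos n j nn0 jn.
have -> : (fun l => interval_pow rat D.+1 (n + k) (j%:Z - l%:Z))
  = fun l => coefz ((\sum_(c < D.+1) 'X^c) ^+ (n + k) : {poly rat}) (j%:Z - l%:Z).
  by apply: functional_extensionality => l; rewrite interval_powE.
rewrite iter_nabla_coefz /= froberg_ratio_diff.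
have -> : (1 - 'X) ^+ k * (\sum_(c < D.+1) 'X^c) ^+ (n + k)
    = map_poly intr
        ((1 - 'X) ^+ k * (\sum_(c < D.+1) 'X^c) ^+ (n + k) : {poly int})
    :> {poly rat}.
  rewrite rmorphM !rmorphXn rmorphB rmorph1 /= map_polyX rmorph_sum /=.
  by congr (_ * _ ^+ _); apply: eq_bigr => c _; rewrite map_polyXn.
by rewrite coef_map /= ltr0z.
Qed.

End FrobergRatio.

(** * Hilbert functions along a chain of ideals *)

Section HomogeneousComponents.

Variables (K : fieldType) (n : nat).
Implicit Types p g f : {mpoly K[n]}.

Lemma pihomogM_homog d i g f : f \is d.-homog ->
  pihomog mdeg i (g * f) = if (d <= i)%N then pihomog mdeg (i - d) g * f else 0.
Proof.
move=> fd.
rewrite (pihomog_partitionE (leqnn (mmeasure mdeg g))) mulr_suml !linear_sum /=.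
transitivity (\sum_(e < mmeasure mdeg g)
  if (d <= i)%N then pihomog mdeg (i - d) (pihomog mdeg e g) * f else 0).
  apply: eq_bigr => e _.
  have he := dhomogM (pihomogP mdeg e g) fd.
  case: (eqVneq (e + d)%N i) => [<-|ne].
    by rewrite addnK leq_addl (pihomog_dE he) pihomog_id.
  rewrite (pihomog_ne0 ne he); case: ifP => // di.
  rewrite (@pihomog_ne0 _ _ _ e) ?mul0r ?pihomogP //.
  by apply: contraNN ne => /eqP ->; rewrite subnK.
by case: ifP => _; rewrite ?mulr_suml // big1.
Qed.

End HomogeneousComponents.

Section HilbertChain.

Variables (K : fieldType) (n : nat).

(** A left kernel vector of the coordinate matrix would be a relation between the [e j] modulo the
    ideal. The spanning family is indexed by a finite type because it will be a disjoint union. *)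
Lemma free_le_span m (f : 'I_m -> {mpoly K[n]}) s (T : finType)
    (e : 'I_s -> {mpoly K[n]}) (e' : T -> {mpoly K[n]}) :
  (forall j, exists c : T -> K, ideal_gen f (e j - \sum_t c t *: e' t)) ->
  (forall c : 'I_s -> K, ideal_gen f (\sum_j c j *: e j) -> forall j, c j = 0) ->
  (s <= #|T|)%N.
Proof.
move=> coefs free.
pose c j := sval (constructive_indefinite_description _ (coefs j)).
have cP j : ideal_gen f (e j - \sum_t c j t *: e' t).
  by rewrite /c; case: constructive_indefinite_description.
pose B : 'M[K]_(s, #|T|) := \matrix_(j, k) c j (enum_val k).
suff /eqP <- : row_free B by apply: rank_leq_col.
rewrite -kermx_eq0; apply/rowV0P => v /sub_kermxP vB.
apply/rowP => j; rewrite mxE; apply: (free (fun j => v 0 j)).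
have -> : \sum_j v 0 j *: e j = \sum_j v 0 j *: (e j - \sum_t c j t *: e' t).
  under [RHS]eq_bigr do rewrite scalerBr scaler_sumr.
  rewrite sumrB exchange_big /= [X in _ - X]big1 ?subr0 // => t _.
  under eq_bigr do rewrite scalerA.
  rewrite -scaler_suml.
  have -> : \sum_j v 0 j * c j t = \sum_j v 0 j * B j (enum_rank t).
    by apply: eq_bigr => i _; rewrite mxE enum_rankK.
  have /rowP/(_ (enum_rank t)) := vB; rewrite !mxE => ->; exact: scale0r.
by apply: ideal_gen_sum => i; apply: ideal_genZ.
Qed.

Lemma quotient_dim_span m (f : 'I_m -> {mpoly K[n]}) i r :
  quotient_dim (ideal_gen f) i r ->
  exists2 e : 'I_r -> {mpoly K[n]}, (forall j, e j \is i.-homog) &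
    (forall p, p \is i.-homog ->
      exists c : 'I_r -> K, ideal_gen f (p - \sum_j c j *: e j)) /\
    (forall c : 'I_r -> K, ideal_gen f (\sum_j c j *: e j) -> forall j, c j = 0).
Proof.
move=> [e eh eP]; exists e => //; split=> [p /eP[c [cP _]]|c cP j].
  by exists c.
have [c0 [_ uniq]] := eP 0 (rpred0 _).
have h1 : c0 = [ffun=> 0].
  apply: uniq; rewrite big1 ?subr0; first exact: ideal_gen0.
  by move=> k _; rewrite ffunE scale0r.
have h2 : c0 = [ffun j => - c j].
  apply: uniq; rewrite sub0r -sumrN.
  by under eq_bigr do rewrite ffunE scaleNr opprK.
have /ffunP/(_ j) := etrans (esym h2) h1; rewrite !ffunE => /eqP.
by rewrite oppr_eq0 => /eqP.
Qed.

Lemma ideal_genM m (f : 'I_m -> {mpoly K[n]}) a p :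
  ideal_gen f p -> ideal_gen f (a * p).
Proof.
move=> [g ->]; exists (fun j => a * g j).
by rewrite mulr_sumr; apply: eq_bigr => j _; rewrite mulrA.
Qed.

Variables (F : nat -> {mpoly K[n]}) (d : nat).
Hypothesis F_homog : forall j, F j \is d.-homog.

Let I j := @ideal_gen K j n (fun l => F l).
Let h j := hilbert_series (I j).

Lemma ideal_gen_recr j p : I j.+1 p <-> exists g, I j (p - g * F j).
Proof.
split=> [[g ->]|[g [g' e]]].
  exists (g ord_max); rewrite big_ord_recr addrK.
  by exists (fun l => g (widen_ord (leqnSn j) l)).
exists (fun l => if unlift ord_max l is Some l' then g' l' else g).
rewrite big_ord_recr /= unlift_none; apply/eqP; rewrite -subr_eq; apply/eqP.
rewrite e; apply: eq_bigr => l _.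
have -> : widen_ord (leqnSn j) l = lift ord_max l.
  by apply: val_inj; rewrite /= /bump leqNgt ltn_ord.
by rewrite liftK.
Qed.

Lemma ideal_gen_pihomog j i p : I j p -> I j (pihomog mdeg i p).
Proof.
move=> [g ->]; rewrite linear_sum /=; apply: ideal_gen_sum => l.
rewrite (pihomogM_homog _ _ (F_homog l)); case: ifP => _; last exact: ideal_gen0.
apply: ideal_genM; exists (fun l' => (l' == l)%:R).
rewrite (bigD1 l) //= eqxx mul1r big1 ?addr0 // => l' /negPf ->.
by rewrite mul0r.
Qed.

(** Passing to the component of degree [i] makes the cofactor of [F j] homogeneous of degree
    [i - d], and kills it when [i < d]. *)
Lemma ideal_gen_recr_homog j i p : p \is i.-homog -> I j.+1 p ->
  if (d <= i)%N then exists2 g, g \is (i - d).-homog & I j (p - g * F j)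
  else I j p.
Proof.
move=> ph /ideal_gen_recr[g /(ideal_gen_pihomog i)].
rewrite linearB /= pihomog_dE // (pihomogM_homog _ _ (F_homog j)).
case: ifP => _; last by rewrite subr0.
by exists (pihomog mdeg (i - d) g) => //; apply: pihomogP.
Qed.

Lemma hilbert_chain_lt j i : (i < d)%N -> (h j i <= h j.+1 i)%N.
Proof.
move=> id.
have [e eh [_ free]] :=
  quotient_dim_span (hilbert_series_genP (fun l : 'I_j => F l) i).
have [e' e'h [span _]] :=
  quotient_dim_span (hilbert_series_genP (fun l : 'I_j.+1 => F l) i).
rewrite -/(h j i) -/(h j.+1 i) in e eh free e' e'h span.
rewrite -[leqRHS]card_ord; apply: (free_le_span (e' := e')) free => l.
have [c Ic] := span _ (eh l); exists c.
have hom : e l - \sum_t c t *: e' t \is i.-homog.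
  by rewrite rpredB // rpred_sum // => t _; rewrite rpredZ.
by have := ideal_gen_recr_homog hom Ic; rewrite leqNgt id.
Qed.


(** Multiplication by [F j] from degree [i - d] to degree [i] of the quotient by [I j] has as
    cokernel degree [i] of the quotient by [I j.+1]. *)
Lemma hilbert_chain_le j i : (d <= i)%N ->
  (h j i <= h j.+1 i + h j (i - d))%N.
Proof.
move=> di.
have [e eh [_ free]] :=
  quotient_dim_span (hilbert_series_genP (fun l : 'I_j => F l) i).
have [e' e'h [span _]] :=
  quotient_dim_span (hilbert_series_genP (fun l : 'I_j.+1 => F l) i).
have [b bh [bspan _]] :=
  quotient_dim_span (hilbert_series_genP (fun l : 'I_j => F l) (i - d)).
rewrite -/(h j i) -/(h j.+1 i) -/(h j (i - d)) in e eh free e' e'h span b bh bspan.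
have -> : (h j.+1 i + h j (i - d))%N = #|{: 'I_(h j.+1 i) + 'I_(h j (i - d))}|.
  by rewrite card_sum !card_ord.
apply: (free_le_span (e' := fun t => match t with inl k => e' k
  | inr k => b k * F j end)) free => l.
have [c Ic] := span _ (eh l).
have hom : e l - \sum_t c t *: e' t \is i.-homog.
  by rewrite rpredB // rpred_sum // => t _; rewrite rpredZ.
have := ideal_gen_recr_homog hom Ic; rewrite di => -[g gh Ig].
have [a Ia] := bspan _ gh.
exists (fun t => match t with inl k => c k | inr k => a k end).
have -> : e l - \sum_t match t with inl k => c k | inr k => a k end *:
    match t with inl k => e' k | inr k => b k * F j end
  = (e l - \sum_t c t *: e' t - g * F j) + F j * (g - \sum_t a t *: b t).
  rewrite big_sumType /= mulrBr mulr_sumr.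
  under [X in _ = _ + (_ - X)]eq_bigr do rewrite -scalerAr mulrC.
  ring.
by apply: ideal_genD => //; apply: ideal_genM.
Qed.

Lemma hilbert_chain_strict j i g : (d <= i)%N ->
  g \is (i - d).-homog -> ~ I j g -> I j (g * F j) ->
  (h j i < h j.+1 i + h j (i - d))%N.
Proof.
move=> di gh nIg IgF.
have [e eh [_ free]] :=
  quotient_dim_span (hilbert_series_genP (fun l : 'I_j => F l) i).
have [e' e'h [span _]] :=
  quotient_dim_span (hilbert_series_genP (fun l : 'I_j.+1 => F l) i).
have [b bh [bspan _]] :=
  quotient_dim_span (hilbert_series_genP (fun l : 'I_j => F l) (i - d)).
rewrite -/(h j i) -/(h j.+1 i) -/(h j (i - d)) in e eh free e' e'h span b bh bspan.
have [u Iu] := bspan _ gh.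
have [k0 uk0] : exists k0, u k0 != 0.
  apply/existsP; apply: contra_notT nIg => /existsPn u0.
  move: Iu; rewrite big1 ?subr0 // => k _; move: (u0 k).
  by rewrite negbK => /eqP ->; rewrite scale0r.
have card : (h j.+1 i + (h j (i - d)).-1)%N
    = #|{: 'I_(h j.+1 i) + 'I_(h j (i - d)).-1}| by rewrite card_sum !card_ord.
have -> : (h j.+1 i + h j (i - d))%N = (h j.+1 i + (h j (i - d)).-1).+1.
  by have := ltn_ord k0; lia.
rewrite ltnS card.
apply: (free_le_span (e' := fun t => match t with inl k => e' k
  | inr k => b (lift k0 k) * F j end)) free => l.
have [c Ic] := span _ (eh l).
have hom : e l - \sum_t c t *: e' t \is i.-homog.
  by rewrite rpredB // rpred_sum // => t _; rewrite rpredZ.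
have := ideal_gen_recr_homog hom Ic; rewrite di => -[g' g'h Ig].
have [a Ia] := bspan _ g'h.
(* Subtracting the multiple [x] of the coordinates [u] of [g] eliminates the basis element
   [b k0]. *)
pose x := a k0 / u k0; pose a' k := a k - x * u k.
exists (fun t => match t with inl k => c k | inr k => a' (lift k0 k) end).
have a'0 : a' k0 = 0 by rewrite /a' /x divfK ?subrr.
have -> : e l - \sum_t match t with inl k => c k | inr k => a' (lift k0 k) end *:
    match t with inl k => e' k | inr k => b (lift k0 k) * F j end
  = (e l - \sum_t c t *: e' t - g' * F j) + F j * (g' - \sum_t a t *: b t)
    - F j * (x *: (g - \sum_t u t *: b t)) + x *: (g * F j).
  have -> : \sum_t a t *: b t = \sum_t a' t *: b t + x *: \sum_t u t *: b t.
    rewrite scaler_sumr -big_split /=; apply: eq_bigr => k _.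
    by rewrite /a' scalerBl scalerA subrK.
  rewrite [\sum_t a' t *: b t](bigD1_ord k0) //= a'0 scale0r add0r.
  rewrite big_sumType /= scalerBr scalerAl.
  have -> : \sum_i0 a' (lift k0 i0) *: (b (lift k0 i0) * F j)
    = F j * \sum_i0 a' (lift k0 i0) *: b (lift k0 i0).
    by rewrite mulr_sumr; apply: eq_bigr => k _; rewrite -scalerAr mulrC.
  ring.
apply: ideal_genD; last exact: ideal_genZ.
apply: ideal_genB; last by apply: ideal_genM; apply: ideal_genZ.
by apply: ideal_genD => //; apply: ideal_genM.
Qed.

(** The coefficient counts the monomials of degree [i], which are independent modulo the zero
    ideal. *)
Lemma froberg_ratio0_le i : froberg_ratio n 0 d i <= (h 0 i)%:Z.
Proof.
have [e eh [span _]] :=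
  quotient_dim_span (hilbert_series_genP (fun l : 'I_0 => F l) i).
rewrite -/(h 0 i) in e eh span.
pose A := [pred f : {ffun 'I_n -> 'I_i.+1} | (\sum_k f k)%N == i].
have -> : froberg_ratio n 0 d i = #|A|%:Z.
  rewrite /froberg_ratio expr0 mul1r -[n in _ ^+ n]card_ord -prodr_const.
  rewrite bigA_distr_bigA coef_sum /=.
  rewrite -[Posz _]natz -sum1_card natr_sum [RHS]big_mkcond /=; apply: eq_bigr => f _.
  by rewrite -expr_sum coefXn eq_sym inE; case: eqP.
rewrite lez_nat -[leqRHS]card_ord.
pose mon (k : 'I_#|A|) : 'X_{1..n} := [multinom (enum_val k j : nat) | j < n].
have mon_inj : injective mon.
  move=> k k' /mnmP ekk; apply: enum_val_inj; apply/ffunP => j; apply: val_inj.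
  by have := ekk j; rewrite !mnmE.
apply: (@free_le_span _ (fun l : 'I_0 => F l) _ _ (fun k => 'X_[mon k]) e).
  move=> k; apply: span; rewrite dhomogX /= mdegE.
  under eq_bigr do rewrite mnmE.
  exact: (enum_valP k).
move=> c [g]; rewrite big_ord0 => e0 k; have := congr1 (mcoeff (mon k)) e0.
rewrite mcoeff0 linear_sum (bigD1 k) //= mcoeffZ mcoeffX eqxx mulr1 big1 ?addr0 //.
move=> k' nk; rewrite mcoeffZ mcoeffX; case: eqP => [/mon_inj ee|]; last by rewrite mulr0.
by rewrite ee eqxx in nk.
Qed.

Lemma hilbert_series_not_froberg N j0 i g : (0 < d)%N -> (j0 < N)%N -> (d <= i)%N ->
  g \is (i - d).-homog -> ~ I j0 g -> I j0 (g * F j0) ->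
  (forall i', (i' <= i)%N -> 0 < froberg_ratio n N d i') ->
  ~ (forall i', (h N i')%:Z = froberg_series n N d i').
Proof.
move=> d0 j0N di gh nIg IgF pos HF.
have top i' : (i' <= i)%N -> (h N i')%:Z = froberg_ratio n N d i'.
  move=> ii; rewrite HF /froberg_series /truncate_nonpos.
  case: ifPn => // /forallPn[x]; rewrite pos //.
  by rewrite (leq_trans _ ii) // -ltnS.
have chainz j i' : (h j i')%:Z
    <= (h j.+1 i')%:Z + (if (d <= i')%N then (h j (i' - d))%:Z else 0).
  by case: leqP => ii; [rewrite -PoszD lez_nat hilbert_chain_le
                       |rewrite addr0 lez_nat hilbert_chain_lt].
(* Descending induction on the number of powers, starting from equality at [N]. The inner induction
   on the degree bounds the term in degree [i' - d] for the same number of powers. *)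
have bound t : (t <= N)%N -> forall i', (i' <= i)%N ->
    (h (N - t) i')%:Z <= froberg_ratio n (N - t) d i'.
  elim: t => [|t IH] tN i' ii; first by rewrite subn0 top.
  have eN : (N - t)%N = (N - t.+1).+1 by lia.
  elim/ltn_ind: i' ii => i' IHi ii.
  have := IH (ltnW tN) i' ii; rewrite eN froberg_ratioS => IHt.
  have := chainz (N - t.+1)%N i'.
  case: leqP IHt => di' IHt; last by lia.
  have := IHi (i' - d)%N ltac:(lia) ltac:(lia); lia.
(* The strict inequality for [j0] powers descends to no power at all, where it contradicts
   [froberg_ratio0_le]. *)
have strict t : (t <= j0)%N -> (h (j0 - t) i)%:Z < froberg_ratio n (j0 - t) d i.
  elim: t => [|t IH] tj; last first.
    have eN : (j0 - t)%N = (j0 - t.+1).+1 by lia.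
    have := IH (ltnW tj); have := chainz (j0 - t.+1)%N i.
    rewrite eN froberg_ratioS di.
    have := bound (N - (j0 - t.+1))%N ltac:(lia) (i - d)%N ltac:(lia).
    have -> : (N - (N - (j0 - t.+1)))%N = (j0 - t.+1)%N by lia.
    lia.
  rewrite subn0.
  have := bound (N - j0)%N ltac:(lia) (i - d)%N ltac:(lia).
  have := bound (N - j0.+1)%N ltac:(lia) i (leqnn i).
  have -> : (N - (N - j0))%N = j0 by lia.
  have -> : (N - (N - j0.+1))%N = j0.+1 by lia.
  rewrite froberg_ratioS di.
  have := hilbert_chain_strict di gh nIg IgF; lia.
have := strict j0 (leqnn _); rewrite subnn.
have := froberg_ratio0_le i; lia.
Qed.

End HilbertChain.

(** * The syzygy *)

Section Syzygy.

Variables (R : comNzRingType) (n d : nat).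

Definition fiber_size (i : nat) (f : {ffun 'I_i -> 'I_n}) (k : 'I_n) : nat :=
  #|[pred s | f s == k]|.

Definition small_fibers (i : nat) (f : {ffun 'I_i -> 'I_n}) : bool :=
  [forall k, (fiber_size f k < d)%N].

Lemma prod_fibers (S : comNzRingType) i (f : {ffun 'I_i -> 'I_n}) (w : 'I_n -> S) :
  \prod_s w (f s) = \prod_k w k ^+ fiber_size f k.
Proof.
rewrite (partition_big f predT) //=; apply: eq_bigr => k _.
by rewrite -prodr_const; apply: eq_big => s /=; [rewrite inE | move=> /eqP ->].
Qed.

Lemma sum_fibers i (f : {ffun 'I_i -> 'I_n}) : (\sum_k fiber_size f k = i)%N.
Proof.
transitivity (\sum_(s < i) 1)%N; last by rewrite sum1_card card_ord.
rewrite (partition_big f predT) //=; apply: eq_bigr => k _.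
by rewrite sum1_card.
Qed.

Implicit Types w c : 'I_n -> R.

(* Modulo the [w k ^+ d], this is
   [(\sum_k w k / (1 + c k *: 'X)) ^+ i * \prod_k (1 + c k *: 'X) ^+ d.-1]. *)
Definition clearing_poly i w c : {poly R} :=
  \sum_(f : {ffun 'I_i -> 'I_n} | small_fibers f)
    (\prod_s w (f s)) *: \prod_k (1 + c k *: 'X) ^+ (d.-1 - fiber_size f k).

Variable I : R -> Prop.
Hypotheses (I0 : I 0) (ID : forall x y, I x -> I y -> I (x + y))
  (IM : forall a x, I x -> I (a * x)).

Let IX (p : {poly R}) := forall l, I p`_l.

Lemma ideal_sum (J : finType) (P : pred J) (F : J -> R) :
  (forall j, P j -> I (F j)) -> I (\sum_(j | P j) F j).
Proof. by move=> IF; elim/big_ind: _. Qed.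

Lemma idealX_mul p q : IX q -> IX (p * q).
Proof. by move=> Iq l; rewrite coefM; apply: ideal_sum => j _; apply: IM. Qed.

(** Expanding the power, a choice [f] of one summand per factor contributes a monomial in the [w k]
    times the product of the [(1 + c k X)^(i - fiber_size f k)]. If some fiber has [d] elements the
    monomial is in the ideal; otherwise all exponents are at least [i - d.-1] and the common factor
    comes out. *)
Lemma clearing_polyE i w c : (0 < d)%N -> (d <= i)%N -> (forall k, I (w k ^+ d)) ->
  IX ((\sum_k w k *: \prod_(j | j != k) (1 + c j *: 'X)) ^+ i
      - (\prod_k (1 + c k *: 'X)) ^+ (i - d.-1) * clearing_poly i w c).
Proof.
move=> d0 di Iw; set lam := fun k => 1 + c k *: 'X.
have fib_le (f : {ffun 'I_i -> 'I_n}) k : (fiber_size f k <= i)%N.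
  by rewrite -[leqRHS]card_ord max_card.
rewrite -[X in _ ^+ X - _]card_ord -prodr_const bigA_distr_bigA /=.
rewrite (bigID (@small_fibers i)) /= /clearing_poly mulr_sumr.
have expand (f : {ffun 'I_i -> 'I_n}) :
   \prod_s (w (f s) *: \prod_(j | j != f s) lam j)
   = (\prod_s w (f s)) *: \prod_k lam k ^+ (i - fiber_size f k).
  rewrite scaler_prod; congr (_ *: _).
  rewrite (exchange_big_dep predT) //=; apply: eq_bigr => k _.
  rewrite prodr_const; congr (_ ^+ _).
  rewrite -[X in (X - _)%N]card_ord -(cardC [pred s | f s == k]) addKn.
  by apply: eq_card => s; rewrite !inE eq_sym.
rewrite addrAC -sumrB big1 ?add0r => [|f /forallP sf].
  move=> l; rewrite coef_sum; apply: ideal_sum => f /forallPn[k].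
  rewrite -leqNgt => dk; rewrite expand coefZ mulrC; apply: IM.
  rewrite prod_fibers (bigD1 k) //= mulrC -(subnK dk) exprD mulrA.
  exact: IM.
rewrite expand -scalerAr -prodrXl -big_split /=; apply/eqP; rewrite subr_eq0.
apply/eqP; congr (_ *: _); apply: eq_bigr => k _; rewrite -exprD; congr (_ ^+ _).
by have := sf k; lia.
Qed.

Lemma poly_inv_mod (p : {poly R}) N : p`_0 = 1 ->
  exists V W : {poly R}, V * p = 1 + 'X^N * W.
Proof.
elim/poly_ind: p => [|r a _]; first by rewrite coef0 => /esym/eqP; rewrite oner_eq0.
rewrite coefD coefMX coefC /= add0r => ->.
exists (\sum_(j < N) (- (r * 'X)) ^+ j), (- (- r) ^+ N).
have -> : r * 'X + 1%:P = - (- (r * 'X) - 1) by rewrite opprB opprK addrC polyC1.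
rewrite mulrN mulrC -subrX1 -mulNr exprMn; ring.
Qed.

Lemma prod_linear_low (P : pred 'I_n) c : exists q : {poly R},
  \prod_(j | P j) (1 + c j *: 'X) = 1 + 'X * ((\sum_(j | P j) c j)%:P + 'X * q).
Proof.
elim/big_rec2: _ => [|j x y _ [q ->]]; first by exists 0; rewrite mulr0 addr0 mulr0 addr0.
exists (q + (c j)%:P * (x%:P + 'X * q)).
by rewrite -mul_polyC polyCD; ring.
Qed.

(** Modulo the ideal, [clearing_poly] is [L^i] over a power of [D], a series with constant term 1.
    As [L = A + X N], only the terms [A^(i - a) (X N)^a] with [a <= l] reach degree [l]; all are
    divisible by [A^(i - l)], and after this division only [a = l] survives modulo [A]. *)
Lemma coef_clearing_poly i l w c : (0 < d)%N -> (d <= i)%N -> (l <= i)%N ->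
  (forall k, I (w k ^+ d)) ->
  exists h, I ((clearing_poly i w c)`_l - (\sum_k w k) ^+ (i - l)
    * ('C(i, l)%:R * (- \sum_k w k * c k) ^+ l + (\sum_k w k) * h)).
Proof.
move=> d0 di li Iw; have := clearing_polyE c d0 di Iw.
set L := \sum_k _ *: _; set D := \prod_k _; set Q := clearing_poly i w c; move=> LQ.
(* [A] and [B] are the value and the derivative of [L] at 0. *)
set A := \sum_k w k; pose B := A * (\sum_k c k) - \sum_k w k * c k.
have [q Lq] : exists q, L = A%:P + 'X * (B%:P + 'X * q).
  have -> : B = \sum_k w k * \sum_(j | j != k) c j.
    rewrite /B mulr_suml -sumrB; apply: eq_bigr => k _.
    by rewrite [\sum_k c k](bigD1 k) //=; ring.
  rewrite /L /A; elim/big_rec3: _ => [|k x y z _ [q ->]].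
    by exists 0; rewrite !polyC0 !(mulr0, addr0).
  have [q' ->] := prod_linear_low (fun j => j != k) c.
  exists ((w k)%:P * q' + q); rewrite -mul_polyC !polyCD polyCM; ring.
have [q1 D1] : exists q, D = 1 + 'X * ((\sum_k c k)%:P + 'X * q).
  exact: prod_linear_low predT c.
have Dm0 : (D ^+ (i - d.-1))`_0 = 1.
  rewrite D1; have [q2 ->] := expr_add_mul 1 ((\sum_k c k)%:P + 'X * q1) 'X (i - d.-1).
  by rewrite expr1n coefD coefXM coef1 addr0.
have [V [W VD]] : exists V W : {poly R}, V * D ^+ (i - d.-1) = 1 + 'X^(l.+1) * W.
  exact: poly_inv_mod.
have V0 : V`_0 = 1.
  have := congr1 (coefp 0) VD; rewrite /coefp coefD coefXnM coef1 addr0 coef0M.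
  by rewrite Dm0 mulr1.
set N := B%:P + 'X * q in Lq.
pose u a := 'C(i, a)%:R * (V * N ^+ a)`_(l - a).
have VL : (V * L ^+ i)`_l = A ^+ (i - l) * (u l + A * \sum_(a < l) A ^+ (l - a.+1) * u a).
  rewrite Lq exprDn mulr_sumr coef_sum.
  transitivity (\sum_(a < i.+1) if (a <= l)%N then A ^+ (i - a) * u a else 0).
    apply: eq_bigr => a _; rewrite exprMn -polyC_exp.
    have -> : V * ((A ^+ (i - a))%:P * ('X^a * N ^+ a) *+ 'C(i, a))
      = (A ^+ (i - a) * 'C(i, a)%:R)%:P * ('X^a * (V * N ^+ a)).
      by rewrite polyCM [('C(i, a)%:R)%:P]rmorph_nat -mulr_natr; ring.
    rewrite coefCM coefXnM; by case: ltnP => _ /=; rewrite ?mulr0 // /u mulrA.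
  rewrite -big_mkcond /=.
  rewrite -(big_ord_widen i.+1 (fun a => A ^+ (i - a) * u a) (n1 := l.+1)) //.
  rewrite big_ord_recr /= mulrDr addrC; congr (_ + _).
  rewrite mulrA mulr_sumr; apply: eq_bigr => a _; rewrite mulrA -exprSr -exprD.
  by congr (A ^+ _ * _); have := ltn_ord a; lia.
have [q' Bl] : exists q', B ^+ l = (- \sum_k w k * c k) ^+ l + A * q'.
  by rewrite /B addrC; apply: expr_add_mul.
exists ('C(i, l)%:R * q' + \sum_(a < l) A ^+ (l - a.+1) * u a).
have ul : u l = 'C(i, l)%:R * B ^+ l.
  rewrite /u subnn coef0M V0 mul1r /N.
  have [q'' ->] := expr_add_mul B%:P q 'X l.
  by rewrite coefD coefXM addr0 -polyC_exp coefC.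
have := IM (-1) (idealX_mul V LQ l).
have -> : V * (L ^+ i - D ^+ (i - d.-1) * Q) = V * L ^+ i - Q - 'X^(l.+1) * (W * Q).
  by rewrite mulrBr [V * (_ * Q)]mulrA VD; ring.
rewrite !coefB coefXnM ltnSn subr0 VL ul Bl.
set x := (X in I X -> _); set y := (X in _ -> I X).
by have -> : x = y by rewrite /x /y; ring.
Qed.

(** * Inverting the parameter of the curve *)

Definition coef_reversal (E : nat) (p p' : {poly R}) : Prop :=
  forall z : int, coefz p z = coefz p' (E%:Z - z).

Lemma coefzZ a (p : {poly R}) z : coefz (a *: p) z = a * coefz p z.
Proof. by case: z => z /=; rewrite ?coefZ ?mulr0. Qed.

Lemma coef_reversal_linear E p p' (a : R) e : coef_reversal E p p' ->
  coef_reversal (e + E) ((1 - a *: 'X) ^+ e * p) (('X - a%:P) ^+ e * p').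
Proof.
move=> rev; elim: e => [|e IH] z; first by rewrite !mul1r.
rewrite !exprS -!mulrA; move: IH; set r := _ * p; set r' := _ * p' => IH.
have -> : (1 - a *: 'X) * r = r - a *: ('X^1 * r) by rewrite -!mul_polyC; ring.
have -> : ('X - a%:P) * r' = 'X^1 * r' - a *: r' by rewrite -!mul_polyC; ring.
rewrite !coefzB !coefzZ !coefz_mulXn !IH.
by congr (coefz _ _ - _ * coefz _ _); lia.
Qed.

Lemma coef_reversal_prod (a : 'I_n -> R) (e : 'I_n -> nat) :
  coef_reversal (\sum_k e k)
    (\prod_k (1 - a k *: 'X) ^+ e k) (\prod_k ('X - (a k)%:P) ^+ e k).
Proof.
elim/big_rec3: _ => [z|k p p' E _ rev]; last exact: coef_reversal_linear.
by case: z => [[|z]|z] //=; rewrite coef1.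
Qed.

(** The reverse of [1 - b X] is [X - b = - b (1 - g X)], and all summands have total exponent
    [n * d.-1 - i]. Relating the expansions at 0 and at infinity in this way plays the role of the
    residue theorem. *)
Lemma coef_clearing_poly_reversal i q (y b g : 'I_n -> R) : (0 < d)%N -> (d <= i)%N ->
  (forall k, b k * g k = 1) -> (q + i <= n * d.-1)%N ->
  (clearing_poly i y (fun k => - b k))`_q
  = (\prod_k (- b k) ^+ d.-1)
    * (clearing_poly i (fun k => - (g k * y k)) (fun k => - g k))`_(n * d.-1 - i - q).
Proof.
move=> d0 di bg qi; rewrite !coef_sum mulr_sumr; apply: eq_bigr => f /forallP sf.
rewrite !coefZ.
pose e k := (d.-1 - fiber_size f k)%N.
have eE : (\sum_k e k = n * d.-1 - i)%N.
  rewrite sumnB; last by move=> k _; have := sf k; lia.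
  by rewrite sum_fibers sum_nat_const card_ord.
have /(_ q%:Z) := coef_reversal_prod b e; rewrite eE.
have -> : (n * d.-1 - i)%:Z - q%:Z = (n * d.-1 - i - q)%N by lia.
rewrite /=; under eq_bigr do rewrite -scaleNr; move=> ->.
have -> : \prod_k ('X - (b k)%:P) ^+ e k
   = (\prod_k (- b k) ^+ e k) *: \prod_k (1 + - g k *: 'X) ^+ e k.
  rewrite -scaler_prod; apply: eq_bigr => k _; rewrite -exprZn; congr (_ ^+ _).
  by rewrite scalerDr scalerA mulrNN bg scale1r -mul_polyC mulr1 polyCN addrC.
rewrite coefZ !mulrA; congr (_ * _).
rewrite (prod_fibers f y) (prod_fibers f (fun k => - (g k * y k))) -!big_split /=.
apply: eq_bigr => k _.
have -> : d.-1 = (e k + fiber_size f k)%N by rewrite subnK //; have := sf k; lia.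
rewrite exprD -mulrA -exprMn mulrNN mulrA.
by rewrite bg mul1r mulrC.
Qed.

(** Up to scalars, the curve passes through [y k] at the parameter [g k], through [\sum_k y k] at 0
    and through [\sum_k g k * y k] at infinity. One coefficient of [clearing_poly] is computed at
    both of the last two points. *)
Lemma syzygy_on_rational_normal_curve e (y b g : 'I_n -> R) : (0 < d)%N ->
  (forall k, b k * g k = 1) -> (2 * e + d <= n * d.-1 <= 3 * e + d)%N ->
  (forall k, I (y k ^+ d)) -> I ((\sum_k y k) ^+ d) ->
  exists h, I ((\sum_k g k * y k) ^+ d
    * ('C(e + d, e)%:R * (\sum_k g k ^+ 2 * y k) ^+ e + (\sum_k g k * y k) * h)).
Proof.
move=> d0 bg /andP[le1 le2] Iy Il.
(* The coefficient of degree [e] at infinity carries exactly the [d]-th power of the last form. It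
   is the coefficient of degree [q] at 0, and [q <= e] makes the exponent [i - q] there at least
   [d]. *)
set i := (e + d)%N; pose q := (n * d.-1 - i - e)%N.
have qe : (n * d.-1 - i - q = e)%N by rewrite /q /i; lia.
have [h1 I1] : exists h,
    I ((clearing_poly i y (fun k => - b k))`_q - (\sum_k y k) ^+ d * h).
  have [h Ih] := @coef_clearing_poly i q y (fun k => - b k) d0 ltac:(lia) ltac:(lia) Iy.
  have di : (d <= i - q)%N by rewrite /q /i; lia.
  move: Ih; rewrite -(subnK di) exprD [_ ^+ _ * _ ^+ d]mulrC -mulrA => Ih.
  by eexists; exact: Ih.
have Iw k : I ((- (g k * y k)) ^+ d) by rewrite -mulNr exprMn; apply: IM.
have [h2 I2] := @coef_clearing_poly i e (fun k => - (g k * y k)) (fun k => - g k)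
  d0 (leq_addl _ _) (leq_addr _ _) Iw.
have := coef_clearing_poly_reversal y d0 (leq_addl e d) bg (q := q)
  ltac:(rewrite /q /i; lia).
rewrite -/i qe => rev.
move: I2; rewrite {1}/i addKn sumrN.
have -> : \sum_k - (g k * y k) * - g k = \sum_k g k ^+ 2 * y k.
  by apply: eq_bigr => k _; ring.
set l' := \sum_k g k * y k; set tau := \sum_k g k ^+ 2 * y k.
set x2 := _`_e in rev *; set x1 := _`_q in rev I1 *; move=> I2.
have Ix1 : I x1.
  have := ID I1 (IM h1 Il); set x := (X in I X -> _).
  by have -> : x = x1 by rewrite /x; ring.
have Ix2 : I x2.
  have := IM (\prod_k (- g k) ^+ d.-1) Ix1; rewrite rev mulrA -big_split /=.
  rewrite big1 ?mul1r // => k _.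
  by rewrite -exprMn mulrNN mulrC bg expr1n.
have sgn m : (-1) ^+ m * (-1) ^+ m = 1 :> R by rewrite -exprMn mulrNN mulr1 expr1n.
exists (- (-1) ^+ e * h2).
have := IM ((-1) ^+ d * (-1) ^+ e) (ID Ix2 (IM (-1) I2)).
rewrite [(- l') ^+ d]exprNn [(- tau) ^+ e]exprNn; set u := 'C(_, _)%:R.
set x := (X in I X -> _); set z := (X in _ -> I X).
suff -> : x = z by [].
transitivity (((-1) ^+ d * (-1) ^+ d) * l' ^+ d
  * (u * ((-1) ^+ e * (-1) ^+ e) * tau ^+ e + l' * (- (-1) ^+ e * h2))).
  by rewrite /x; ring.
by rewrite !sgn /z mul1r mulr1.
Qed.

End Syzygy.

(** * The cofactor is not in the ideal *)

Lemma sum_block (V : nmodType) N (F : nat -> V) j : (3 * j + 2 < N)%N ->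
  \sum_(k < N | (k %/ 3)%N == j) F k = F (3 * j)%N + F (3 * j + 1)%N + F (3 * j + 2)%N.
Proof.
move=> jN.
have h0 : (3 * j < N)%N by lia. have h1 : (3 * j + 1 < N)%N by lia.
rewrite (bigD1 (Ordinal h0)) /=; last by apply/eqP; lia.
rewrite (bigD1 (Ordinal h1)) /=; last by rewrite -val_eqE /=; lia.
rewrite (bigD1 (Ordinal jN)) /=; last by rewrite -!val_eqE /=; lia.
rewrite big_pred0 ?addr0 ?addrA // => k; rewrite -!val_eqE /=; lia.
Qed.

(* Lagrange weights for the second divided difference on the nodes
   [g (3 j)], [g (3 j + 1)], [g (3 j + 2)]. *)
Lemma block_weights (K : fieldType) N (g : nat -> K) :
  (forall a b, (a < N)%N -> (b < N)%N -> g a = g b -> a = b) ->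
  exists eta : nat -> K, forall j, (3 * j + 2 < N)%N ->
    let sum3 F := F (3 * j)%N + F (3 * j + 1)%N + F (3 * j + 2)%N in
    [/\ sum3 eta = 0, sum3 (fun k => g k * eta k) = 0
      & sum3 (fun k => g k ^+ 2 * eta k) = 1].
Proof.
move=> g_inj; pose dv a b c := ((g a - g b) * (g a - g c))^-1.
exists (fun k => match (k %% 3)%N with
  | 0 => dv k k.+1 k.+2 | 1 => dv k k.-1 k.+1 | _ => dv k k.-2 k.-1 end) => j jN /=.
have -> : (3 * j %% 3)%N = 0%N by lia.
have -> : ((3 * j + 1) %% 3)%N = 1%N by lia.
have -> : ((3 * j + 2) %% 3)%N = 2%N by lia.
have ne a b : (a < N)%N -> (b < N)%N -> a != b -> g a - g b != 0.
  by move=> aN bN; apply: contraNneq => /subr0_eq /g_inj ->.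
rewrite addn1 addn2 /= /dv.
have := ne (3 * j)%N (3 * j).+1 ltac:(lia) ltac:(lia) ltac:(lia).
have := ne (3 * j)%N (3 * j).+2 ltac:(lia) ltac:(lia) ltac:(lia).
have := ne (3 * j).+1 (3 * j).+2 ltac:(lia) ltac:(lia) ltac:(lia).
have sym a b : a - b != 0 -> b - a != 0 :> K by rewrite -oppr_eq0 opprB.
move: (g _) (g _) (g _) => x y z yz xz xy.
by have := (sym _ _ yz, sym _ _ xz, sym _ _ xy) => nz; split; field; rewrite yz xz xy !nz.
Qed.


Section SquareTarget.

Variables (K : fieldType) (s : nat).

(** The variable of the triple containing [k]; the sum is empty, hence zero, for indices beyond the
    last of the [s] triples. *)
Definition block_var (k : nat) : {mpoly K[s]} :=
  \sum_(j < s | j == (k %/ 3)%N :> nat) 'X_j.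

Lemma sum_block_var N (F : nat -> K) : (3 * s <= N)%N ->
  \sum_(k < N) F k *: block_var k
  = \sum_(j < s) (F (3 * j)%N + F (3 * j + 1)%N + F (3 * j + 2)%N) *: 'X_j.
Proof.
move=> sN; rewrite /block_var; under eq_bigr do rewrite scaler_sumr.
rewrite (exchange_big_dep predT) //=; apply: eq_bigr => j _.
rewrite -scaler_suml; congr (_ *: _); rewrite -(@sum_block _ N); last first.
  by have := ltn_ord j; lia.
by apply: eq_bigl => k; rewrite eq_sym.
Qed.

Variable d : nat.
Hypothesis charK0 : [pchar K] =i pred0.
Hypothesis d_gt0 : (0 < d)%N.

(** The socle monomial modulo the [d]-th powers of the variables: its coefficient vanishes on their
    ideal and so detects non-membership. *)
Definition top_mnm : 'X_{1..s} := [multinom d.-1 | _ < s].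

Lemma mcoeff_top_mulXn (p : {mpoly K[s]}) j : (p * 'X_j ^+ d)@_top_mnm = 0.
Proof.
rewrite (mpolyE p) mulr_suml linear_sum big1 //= => m _.
rewrite mpolyXn -scalerAl -mpolyXD mcoeffZ mcoeffX.
case: eqP => [/mnmP/(_ j)|]; last by rewrite mulr0.
by rewrite mnmDE mulmnE mnm1E eqxx mul1n mnmE; lia.
Qed.

(** This multinomial coefficient counts the choices of a variable in each factor that take every
    variable [d.-1] times. Indexing the factors by pairs, the first projection is such a choice, and
    a positive integer is nonzero in characteristic zero. *)
Lemma mcoeff_top_exp_sum :
  ((\sum_(j < s) 'X_j) ^+ (s * d.-1) : {mpoly K[s]})@_top_mnm != 0.
Proof.
have -> : (s * d.-1)%N = #|{: 'I_s * 'I_d.-1}| by rewrite card_prod !card_ord.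
rewrite -prodr_const bigA_distr_bigA linear_sum /=.
pose A := [pred f : {ffun 'I_s * 'I_d.-1 -> 'I_s} | (\sum_p U_(f p))%MM == top_mnm].
have -> : \sum_(f : {ffun 'I_s * 'I_d.-1 -> 'I_s}) (\prod_p 'X_(f p) : {mpoly K[s]})@_top_mnm
    = #|A|%:R.
  rewrite -sum1_card natr_sum [RHS]big_mkcond /=; apply: eq_bigr => f _.
  have -> : \prod_p 'X_(f p) = 'X_[\sum_p U_(f p)] :> {mpoly K[s]}.
    by elim/big_rec2: _ => [|p x y _ ->]; rewrite ?mpolyX0 // mpolyXD.
  by rewrite mcoeffX inE; case: eqP.
have /pcharf0P -> := charK0; rewrite -lt0n; apply/card_gt0P.
exists [ffun p => p.1]; rewrite inE; apply/eqP/mnmP => j; rewrite mnm_sumE mnmE.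
under eq_bigr do rewrite ffunE mnm1E.
rewrite -(pair_bigA _ (fun (a : 'I_s) (b : 'I_d.-1) => (a == j : nat))) /=.
rewrite (bigD1 j) //= eqxx sum_nat_const card_ord muln1 big1 ?addn0 // => a /negPf ->.
by rewrite big1.
Qed.

Lemma mcoeff_top_block_var p k : (p * block_var k ^+ d)@_top_mnm = 0.
Proof.
rewrite /block_var; case: (ltnP (k %/ 3) s) => [ks|sk].
  by rewrite (big_pred1 (Ordinal ks)) ?mcoeff_top_mulXn // => j; rewrite -val_eqE.
rewrite big_pred0 ?expr0n => [|j]; last first.
  by apply/negP => /eqP ej; have := ltn_ord j; rewrite ej ltnNge sk.
by rewrite -leqn0 leqNgt d_gt0 mulr0 mcoeff0.
Qed.

Lemma power_notin_ideal_gen n N (lq : n.-tuple {mpoly K[s]}) (L : nat -> {mpoly K[n]})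
    (c : nat -> K) l' tau h u :
  (forall l, (l < N)%N -> L l \mPo lq = c l *: block_var l) ->
  l' \mPo lq = 0 -> tau \mPo lq = \sum_(j < s) 'X_j -> u != 0 ->
  ~ ideal_gen (fun l : 'I_N => L l ^+ d) (u *: tau ^+ (s * d.-1) + l' * h).
Proof.
move=> Lv l'0 tauX u0 [g e].
have := congr1 (fun p => (p \mPo lq)@_top_mnm) e; rewrite [in RHS]rmorph_sum /=.
have -> : (\sum_(j < N) (g j * L j ^+ d \mPo lq))@_top_mnm = 0.
  rewrite linear_sum big1 //= => l _.
  rewrite rmorphM rmorphXn /= Lv // exprZn -scalerAr mcoeffZ.
  by rewrite mcoeff_top_block_var mulr0.
rewrite rmorphD rmorphM /= l'0 mul0r addr0 comp_mpolyZ rmorphXn /= tauX mcoeffZ.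
by move/eqP; rewrite mulf_eq0 (negPf u0) (negPf mcoeff_top_exp_sum).
Qed.

End SquareTarget.

Lemma tangent_power_notin_ideal_gen (K : fieldType) n d (A : 'M[K]_n)
    (L : nat -> {mpoly K[n]}) (a g : nat -> K) h u :
  [pchar K] =i pred0 -> (0 < d)%N -> A \in unitmx ->
  (forall k : 'I_n, L k = \sum_j A k j *: 'X_j) ->
  (forall k, (k < n)%N -> a k != 0) -> L n = \sum_(k < n) a k *: L k ->
  (forall k l, (k < n.+1)%N -> (l < n.+1)%N -> g k = g l -> k = l) -> g n = 0 ->
  u != 0 ->
  ~ ideal_gen (fun l : 'I_n.+1 => L l ^+ d)
      (u *: (\sum_(k < n) (g k ^+ 2 * a k) *: L k) ^+ ((n.+1 %/ 3) * d.-1)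
       + (\sum_(k < n) (g k * a k) *: L k) * h).
Proof.
move=> charK0 d0 Au LA a0 Ln g_inj gn u0; set s := (n.+1 %/ 3)%N.
have [eta etaP] := block_weights g_inj.
have sn : (3 * s <= n.+1)%N by rewrite /s; lia.
(* The substitution [lq] inverts [A] so as to send [L k] to [t k]. Dividing by [a k] leaves pure
   Lagrange weights in the images of the sums of the [a k *: L k]. *)
pose t k := ((a k)^-1 * eta k) *: block_var K s k.
pose lq := [tuple \sum_(k < n) invmx A j k *: t k | j < n].
have Lt k : (k < n)%N -> L k \mPo lq = t k.
  move=> kn; rewrite -[k]/(val (Ordinal kn)) LA rmorph_sum /=.
  transitivity (\sum_(i < n) (A *m invmx A) (Ordinal kn) i *: t i).
    under eq_bigr do rewrite comp_mpolyZ comp_mpolyXU -tnth_nth tnth_mktuple scaler_sumr.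
    rewrite exchange_big /=; apply: eq_bigr => i _.
    by rewrite mxE scaler_suml; apply: eq_bigr => j _; rewrite scalerA.
  rewrite mulmxV // (bigD1 (Ordinal kn)) //= mxE eqxx scale1r big1 ?addr0 // => i.
  by move=> /negPf ni; rewrite mxE eq_sym ni scale0r.
have sumL (b : nat -> K) :
    (\sum_(k < n) (b k * a k) *: L k) \mPo lq
    = \sum_(k < n.+1) (b k * eta k) *: block_var K s k
      - (b n * eta n) *: block_var K s n.
  rewrite big_ord_recr addrK rmorph_sum; apply: eq_bigr => k _ /=.
  by rewrite comp_mpolyZ Lt // /t scalerA mulrA mulfK // a0.
have blk j : (j < s)%N -> (3 * j + 2 < n.+1)%N by move=> js; lia.
(* [L n] is a sum over [k < n], while the weights cancel on full triples of the [n + 1] indices, so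
   the missing term appears with a minus sign. In the other two sums that term vanishes since
   [g n = 0]. *)
pose c l := if (l < n)%N then (a l)^-1 * eta l else - eta n.
apply: (@power_notin_ideal_gen K s d charK0 d0 n n.+1 lq L c) => //.
- move=> l; rewrite /c ltnS leq_eqVlt => /predU1P[->|ln]; last by rewrite ln Lt.
  have := sumL (fun=> 1); rewrite ltnn Ln; under eq_bigr do rewrite mul1r.
  move=> ->; under eq_bigr do rewrite mul1r.
  rewrite mul1r (sum_block_var eta sn) big1 ?sub0r ?scaleNr // => j _.
  by have [/= -> _ _] := etaP j (blk _ (ltn_ord j)); rewrite scale0r.
- rewrite sumL gn mul0r scale0r subr0.
  rewrite (sum_block_var (fun k => g k * eta k) sn) big1 // => j _.
  by have [_ /= -> _] := etaP j (blk _ (ltn_ord j)); rewrite scale0r.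
- rewrite (sumL (fun k => g k ^+ 2)) gn expr0n mul0r scale0r subr0.
  rewrite (sum_block_var (fun k => g k ^+ 2 * eta k) sn); apply: eq_bigr => j _.
  by have [_ _ /= ->] := etaP j (blk _ (ltn_ord j)); rewrite scale1r.
Qed.

(** * Genericity *)

Section Genericity.

(* With [a / \det A0] and [b / \det A0] the coordinates of [r1] and [r2] in the
   basis formed by the rows of [A0], the last factors make the ratios of
   corresponding coordinates distinct. *)
Definition genericity (R : comNzRingType) n (A0 : 'M[R]_n) (r1 r2 : 'rV[R]_n) : R :=
  let a := r1 *m \adj A0 in let b := r2 *m \adj A0 in
  \det A0 * \prod_k a 0 k * \prod_k b 0 k
  * \prod_i \prod_(j | j != i) (a 0 i * b 0 j - a 0 j * b 0 i).

Lemma map_genericity (R S : comNzRingType) (f : {rmorphism R -> S}) n (A0 : 'M_n) r1 r2 :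
  f (genericity A0 r1 r2)
  = genericity (map_mx f A0) (map_mx f r1) (map_mx f r2).
Proof.
have mapE (r : 'rV[R]_n) i : map_mx f r 0 i = f (r 0 i) by rewrite mxE.
rewrite /genericity -map_mx_adj -!map_mxM det_map_mx !rmorphM !rmorph_prod /=.
congr (_ * _ * _ * _).
- by apply: eq_bigr => i _; rewrite mapE.
- by apply: eq_bigr => i _; rewrite mapE.
apply: eq_bigr => i _; rewrite rmorph_prod; apply: eq_bigr => j _.
by rewrite rmorphB !rmorphM !mapE.
Qed.

Variables (K : fieldType) (n k : nat).

Definition mx_genericity (R : comNzRingType) (A : 'M[R]_(n + k.+2, n)) : R :=
  genericity (usubmx A) (row ord0 (dsubmx A)) (row (lift ord0 ord0) (dsubmx A)).

(** The defining polynomial is [mx_genericity] of the matrix of indeterminates; evaluation is a ring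
    morphism and commutes with it. *)
Lemma zariski_open_mx_genericity :
  zariski_open (fun A : 'M[K]_(n + k.+2, n) => mx_genericity A != 0).
Proof.
pose X : 'M[{mpoly K[(n + k.+2) * n]}]_(n + k.+2, n) := vec_mx (\row_i 'X_i).
exists (eq (mx_genericity X)) => A.
pose ev : {rmorphism _ -> _} := meval (fun i => mxvec A 0 i).
have evX : map_mx ev X = A.
  by apply/matrixP => i j; rewrite !mxE /= mevalXU mxvecE.
have <- : ev (mx_genericity X) = mx_genericity A.
  transitivity (mx_genericity (map_mx ev X)); last by rewrite evX.
  by rewrite /mx_genericity map_genericity !map_row map_usubmx map_dsubmx.
by split=> [h|[q <-]] //; exists (mx_genericity X).
Qed.

Lemma exists_mx_genericity : [pchar K] =i pred0 ->
  exists A : 'M[K]_(n + k.+2, n), mx_genericity A != 0.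
Proof.
move=> /pcharf0P char0.
(* The coordinates of the two extra rows are all 1 and [1, ..., n], whose ratios are nonzero and
   distinct in characteristic zero. *)
exists (col_mx 1%:M (\matrix_(i < k.+2, j < n) if i == ord0 then 1 else j.+1%:R)).
rewrite /mx_genericity col_mxKu col_mxKd /genericity adj1 !mulmx1 det1 mul1r.
rewrite mulf_neq0 //; first rewrite mulf_neq0 //.
- by apply/prodf_neq0 => j _; rewrite !mxE oner_eq0.
- by apply/prodf_neq0 => j _; rewrite !mxE /= char0.
apply/prodf_neq0 => i _; apply/prodf_neq0 => j ji; rewrite !mxE /= !mul1r.
rewrite subr_eq0; apply/negP => /eqP e.
have : (j.+1%:R - i.+1%:R == 0 :> K) by rewrite e subrr.
case: (ltngtP i j) => ij.
- by rewrite -natrB ?ltnS ?(ltnW ij) // char0 subSS subn_eq0 leqNgt ij.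
- by rewrite -oppr_eq0 opprB -natrB ?ltnS ?(ltnW ij) // char0 subSS subn_eq0 leqNgt ij.
- by move/val_inj: ij ji => ->; rewrite eqxx.
Qed.

(** The default 0 matters at index [n]: it is the parameter of the form [L n] on the curve. *)
Definition extend0 (f : 'I_n -> K) (l : nat) : K := oapp f 0 (insub l).

Lemma extend0E f (i : 'I_n) : extend0 f i = f i.
Proof. by rewrite /extend0 valK. Qed.

Lemma extend0_ge f l : (n <= l)%N -> extend0 f l = 0.
Proof. by move=> nl; rewrite /extend0 insubN // -leqNgt. Qed.

Lemma mx_genericity_coords (A : 'M[K]_(n + k.+2, n)) (L : nat -> {mpoly K[n]}) :
  mx_genericity A != 0 -> (forall i : 'I_(n + k.+2), L i = linear_forms A i) ->
  usubmx A \in unitmx /\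
  exists a g : nat -> K,
    [/\ forall l, (l < n)%N -> a l != 0, forall l, (l < n)%N -> g l != 0,
        g n = 0,
        forall l m, (l < n.+1)%N -> (m < n.+1)%N -> g l = g m -> l = m
      & L n = \sum_(l < n) a l *: L l /\ L n.+1 = \sum_(l < n) (g l * a l) *: L l].
Proof.
rewrite /mx_genericity /genericity; set A0 := usubmx A.
set r1 := row _ _; set r2 := row _ _.
rewrite !mulf_eq0 !negb_or -!andbA.
move=> /and4P[det0 /prodf_neq0 a0 /prodf_neq0 b0 /prodf_neq0 ab] LA.
have A0u : A0 \in unitmx by rewrite unitmxE unitfE.
split=> //.
pose a := r1 *m \adj A0; pose b := r2 *m \adj A0.
have rE (r : 'rV_n) : (\det A0)^-1 *: (r *m \adj A0) *m A0 = r.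
  by rewrite -scalemxAl -mulmxA mul_adj_mx mul_mx_scalar scalerA mulVf // scale1r.
have LE (i : 'I_n) : L i = \sum_j A0 i j *: 'X_j.
  by rewrite (LA (lshift _ i)); apply: eq_bigr => j _; rewrite mxE.
have comb (r : 'rV_n) : \sum_j r 0 j *: 'X_j
    = \sum_(l < n) ((\det A0)^-1 * (r *m \adj A0) 0 l) *: L l.
  under [RHS]eq_bigr do rewrite LE scaler_sumr.
  rewrite exchange_big; apply: eq_bigr => j _ /=.
  rewrite -{1}(rE r) mxE scaler_suml; apply: eq_bigr => l _.
  by rewrite scalerA mxE.
exists (extend0 (fun i => (\det A0)^-1 * a 0 i)), (extend0 (fun i => b 0 i / a 0 i)).
have an0 i : a 0 i != 0 by apply: a0.
have bn0 i : b 0 i != 0 by apply: b0.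
have gn0 i : b 0 i / a 0 i != 0 by rewrite mulf_neq0 // invr_eq0.
split.
- move=> l ln; rewrite -[l]/(val (Ordinal ln)) extend0E mulf_neq0 ?invr_eq0 //.
- by move=> l ln; rewrite -[l]/(val (Ordinal ln)) extend0E.
- exact: extend0_ge.
- move=> l m; rewrite !ltnS [(l <= n)%N]leq_eqVlt [(m <= n)%N]leq_eqVlt.
  move=> /predU1P[->|ln] /predU1P[->|mn] //.
  + rewrite extend0_ge // -[m]/(val (Ordinal mn)) extend0E => /esym/eqP.
    by rewrite (negPf (gn0 _)).
  + rewrite [RHS]extend0_ge // -[l]/(val (Ordinal ln)) extend0E => /eqP.
    by rewrite (negPf (gn0 _)).
  rewrite -[l]/(val (Ordinal ln)) -[m]/(val (Ordinal mn)) !extend0E => /eqP.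
  rewrite eqr_div // => /eqP e; congr val; apply/eqP/negPn/negP => lm.
  have /prodf_neq0/(_ (Ordinal mn)) := ab (Ordinal ln) isT.
  rewrite eq_sym lm => /(_ isT); rewrite -/a -/b.
  by rewrite mulrC [a 0 _ * b 0 _]mulrC e mulrC subrr eqxx.
split.
- have := LA (rshift n ord0); rewrite /= addn0 => ->.
  have -> : linear_forms A (rshift n ord0) = \sum_j r1 0 j *: 'X_j.
    by apply: eq_bigr => j _; rewrite !mxE.
  by rewrite comb; apply: eq_bigr => l _; rewrite extend0E.
have := LA (rshift n (lift ord0 ord0)); rewrite /= /bump /= addn1 => ->.
have -> : linear_forms A (rshift n (lift ord0 ord0)) = \sum_j r2 0 j *: 'X_j.
  by apply: eq_bigr => j _; rewrite !mxE.
rewrite comb; apply: eq_bigr => l _; rewrite !extend0E; congr (_ *: _).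
by rewrite mulrCA divfK.
Qed.

End Genericity.

(** * Comparison with the predicted series for general forms *)

Theorem theorem4p5 (K : fieldType) (charK0 : [pchar K] =i pred0) (k d : nat)
    (k_ge2 : (2 <= k)%N) (d_ge2 : (2 <= d)%N) :
  exists n0 : nat, forall n : nat, (n0 <= n)%N ->
    @for_general_linear_forms K (n + k) n (fun l =>
      ~ (forall i : nat,
           (hilbert_series (ideal_gen (fun j => l j ^+ d)) i)%:Z
           = froberg_series n (n + k) d i)).
Proof.
have [n0 pos] := froberg_ratio_gt0 k d_ge2.
(* From [35] on, [5 * (e + d) <= 2 * d.-1 * n] for the [e] below, as [e] is at most
   [(n + 1) (d - 1) / 3] and [d] at most [2 (d - 1)]. *)
case: k k_ge2 pos => [|[|k]] // _ pos; exists (n0 + 35)%N => n nn0.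
exists (fun A => mx_genericity A != 0); split.
- exact: zariski_open_mx_genericity.
- exact: exists_mx_genericity.
move=> A genA; pose L l := oapp (linear_forms A) 0 (insub l).
have LA (i : 'I_(n + k.+2)) : L i = linear_forms A i by rewrite /L valK.
have -> : (fun j => linear_forms A j ^+ d) = (fun j : 'I_(n + k.+2) => L j ^+ d).
  by apply: functional_extensionality => j; rewrite LA.
have [A0u [a [g [a0 g0 gn g_inj [Ln LSn]]]]] := mx_genericity_coords genA LA.
have L1 l : L l \is 1.-homog.
  rewrite /L; case: insub => [i|] /=; last exact: rpred0.
  by apply: rpred_sum => j _; rewrite rpredZ // dhomogX /= mdeg1.
have Ld l : L l ^+ d \is d.-homog by have := dhomogMn d (L1 l); rewrite mul1n.
have d0 := ltnW d_ge2.
pose e := ((n.+1 %/ 3) * d.-1)%N.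
pose l' := \sum_(l < n) (g l * a l) *: L l.
pose tau := \sum_(l < n) (g l ^+ 2 * a l) *: L l.
pose I := ideal_gen (fun l : 'I_n.+1 => L l ^+ d).
have IL (l : 'I_n.+1) : I (L l ^+ d).
  exists (fun j => (j == l)%:R); rewrite (bigD1 l) //= eqxx mul1r big1 ?addr0 //.
  by move=> j /negPf ->; rewrite mul0r.
have [h Ih] : exists h, I (l' ^+ d * ('C(e + d, e)%:R * tau ^+ e + l' * h)).
  (* Taking [y l = a l *: L l] turns [L n] into the sum of the [y l] and [L n.+1] into the sum of
     the [g l * y l]. *)
  have := @syzygy_on_rational_normal_curve {mpoly K[n]} n d I (ideal_gen0 _)
    (@ideal_genD _ _ _ _) (@ideal_genM _ _ _ _) e (fun l => a l *: L l)
    (fun l => (g l)^-1%:MP) (fun l => (g l)%:MP) d0.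
  have -> : \sum_(l < n) (g l)%:MP * (a l *: L l) = l'.
    by apply: eq_bigr => l _; rewrite mul_mpolyC scalerA.
  have -> : \sum_(l < n) (g l)%:MP ^+ 2 * (a l *: L l) = tau.
    by apply: eq_bigr => l _; rewrite -rmorphXn /= mul_mpolyC scalerA.
  apply.
  - by move=> l; rewrite -rmorphM /= mulVf ?g0.
  - by rewrite /e; apply/andP; split; nia.
  - by move=> l; rewrite exprZn; apply/ideal_genZ/(IL (widen_ord (leqnSn n) l)).
  - by rewrite -Ln; apply: (IL ord_max).
pose p := 'C(e + d, e)%:R * tau ^+ e + l' * h.
have tau1 : tau \is 1.-homog by apply: rpred_sum => l _; rewrite rpredZ.
have l'1 : l' \is 1.-homog by apply: rpred_sum => l _; rewrite rpredZ.
have l'L : l' = L n.+1 by rewrite LSn.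
(* The polynomial [h] of the syzygy need not be homogeneous, so the cofactor is replaced by its
   component of degree [e]. *)
apply: (@hilbert_series_not_froberg K n (fun l => L l ^+ d) d Ld _ n.+1 (e + d)%N
  (pihomog mdeg e p)) => //.
- by rewrite addnS ltnS; lia.
- exact: leq_addl.
- by rewrite addnK; apply: pihomogP.
- have e0 : (1 <= e)%N by rewrite /e; nia.
  rewrite /p linearD /= [l' * h]mulrC (pihomogM_homog _ _ l'1) e0.
  rewrite -[_%:R * _]/(_ * _) mulr_natl -scaler_nat pihomog_dE; last first.
    by rewrite rpredZ //; have := dhomogMn e tau1; rewrite mul1n.
  rewrite mulrC; apply: (@tangent_power_notin_ideal_gen K n d (usubmx A) L a g) => //.
  + by move=> i; rewrite (LA (lshift _ i)); apply: eq_bigr => j _; rewrite mxE.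
  + have /pcharf0P -> := charK0; by rewrite -lt0n bin_gt0 leq_addr.
- have := ideal_gen_pihomog Ld (e + d) Ih.
  by rewrite mulrC l'L (pihomogM_homog _ _ (Ld n.+1)) leq_addl addnK -l'L.
- move=> i ie; apply: pos; first lia.
  apply: (leq_trans (n := 5 * (e + d))); first by rewrite leq_mul2l ie orbT.
  by rewrite /e; nia.
Qed.
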